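(* Let $K$ and $L$ be locally compact Hausdorff spaces and let $X$ be a real Banach space containing no isomorphic copy of $c_0$. If there exists an isomorphic embedding of $C_0(K)$ into $C_0(L,X)$ and $L$ is scattered, then $K$ is scattered.
   Context: For a locally compact Hausdorff space $K$ and a real Banach space $X$, $C_0(K,X)$ denotes the Banach space of all continuous functions $f:K\to X$ vanishing at infinity, with the norm $\|f\|=\sup_{x\in K}\|f(x)\|$; $C_0(K)=C_0(K,\mathbb{R})$, and $c_0=C_0(\mathbb{N})$. A linear operator $T:X\to Y$ between Banach spaces is an isomorphic embedding if there are $A,B>0$ with $A\|u\|\le\|Tu\|\le B\|u\|$ for all $u\in X$. A topological space is scattered if every nonempty subset has an isolated point (in the relative topology). *)

(* Defs.v *)
From Stdlib Require Import Reals Lra List Classical ClassicalEpsilon.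
Open Scope R_scope.

Record Topology (T : Type) := {
  is_open : (T -> Prop) -> Prop;
  open_full : is_open (fun _ => True);
  open_inter : forall U V, is_open U -> is_open V ->
                 is_open (fun x => U x /\ V x);
  open_union : forall F : (T -> Prop) -> Prop,
                 (forall U, F U -> is_open U) ->
                 is_open (fun x => exists U, F U /\ U x)
}.
Arguments is_open {T} t U.

Definition compact {T} (t : Topology T) (C : T -> Prop) : Prop :=
  forall F : (T -> Prop) -> Prop,
    (forall U, F U -> is_open t U) ->
    (forall x, C x -> exists U, F U /\ U x) ->
    exists l : list (T -> Prop),
      Forall F l /\ (forall x, C x -> exists U, In U l /\ U x).

Definition hausdorff {T} (t : Topology T) : Prop :=
  forall x y : T, x <> y ->
    exists U V, is_open t U /\ is_open t V /\ U x /\ V y /\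
                (forall z, U z -> V z -> False).

Definition locally_compact {T} (t : Topology T) : Prop :=
  forall x : T, exists U C, is_open t U /\ U x /\ compact t C /\
                            (forall y, U y -> C y).

Definition lch {T} (t : Topology T) : Prop :=
  locally_compact t /\ hausdorff t.

Definition scattered {T} (t : Topology T) : Prop :=
  forall A : T -> Prop, (exists x, A x) ->
    exists x, A x /\ exists U, is_open t U /\ U x /\
                       (forall y, A y -> U y -> y = x).

Definition discrete_topology (T : Type) : Topology T.
Proof.
  refine {| is_open := fun _ => True |}; auto.
Defined.

Record NormedSpace := {
  carrier :> Type;
  vzero : carrier;
  vadd : carrier -> carrier -> carrier;
  vscal : R -> carrier -> carrier;
  vnorm : carrier -> R;
  vadd_assoc : forall x y z, vadd x (vadd y z) = vadd (vadd x y) z;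
  vadd_comm : forall x y, vadd x y = vadd y x;
  vadd_zero : forall x, vadd x vzero = x;
  vadd_opp : forall x, vadd x (vscal (-1) x) = vzero;
  vscal_one : forall x, vscal 1 x = x;
  vscal_assoc : forall a b x, vscal a (vscal b x) = vscal (a * b) x;
  vscal_distr_l : forall a x y, vscal a (vadd x y) = vadd (vscal a x) (vscal a y);
  vscal_distr_r : forall a b x, vscal (a + b) x = vadd (vscal a x) (vscal b x);
  vnorm_eq0 : forall x, vnorm x = 0 -> x = vzero;
  vnorm_scal : forall a x, vnorm (vscal a x) = Rabs a * vnorm x;
  vnorm_triang : forall x y, vnorm (vadd x y) <= vnorm x + vnorm y
}.
Arguments vzero {n}.
Arguments vadd {n}.
Arguments vscal {n}.
Arguments vnorm {n}.

Definition vsub {X : NormedSpace} (x y : X) : X := vadd x (vscal (-1) y).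

Definition banach (X : NormedSpace) : Prop :=
  forall u : nat -> X,
    (forall eps, eps > 0 -> exists N, forall m n, (m >= N)%nat -> (n >= N)%nat ->
        vnorm (vsub (u m) (u n)) < eps) ->
    exists l : X, forall eps, eps > 0 -> exists N, forall n, (n >= N)%nat ->
        vnorm (vsub (u n) l) < eps.

Lemma R_vadd_opp : forall x : R, x + (-1) * x = 0. Proof. intros; lra. Qed.
Lemma R_vscal_one : forall x : R, 1 * x = x. Proof. intros; lra. Qed.
Lemma R_vscal_assoc : forall a b x : R, a * (b * x) = a * b * x.
Proof. intros; ring. Qed.
Lemma R_distr_l : forall a x y : R, a * (x + y) = a * x + a * y.
Proof. intros; ring. Qed.
Lemma R_distr_r : forall a b x : R, (a + b) * x = a * x + b * x.
Proof. intros; ring. Qed.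
Lemma R_norm_eq0 : forall x : R, Rabs x = 0 -> x = 0.
Proof. intros x H. destruct (Req_dec x 0); auto. exfalso; apply Rabs_no_R0 in H0; auto. Qed.
Lemma R_add_assoc : forall x y z : R, x + (y + z) = x + y + z.
Proof. intros; ring. Qed.
Lemma R_add_zero : forall x : R, x + 0 = x. Proof. intros; ring. Qed.

Definition R_NS : NormedSpace :=
  {| carrier := R; vzero := 0; vadd := Rplus; vscal := Rmult; vnorm := Rabs;
     vadd_assoc := R_add_assoc; vadd_comm := Rplus_comm; vadd_zero := R_add_zero;
     vadd_opp := R_vadd_opp; vscal_one := R_vscal_one;
     vscal_assoc := R_vscal_assoc; vscal_distr_l := R_distr_l;
     vscal_distr_r := R_distr_r; vnorm_eq0 := R_norm_eq0;
     vnorm_scal := Rabs_mult; vnorm_triang := Rabs_triang |}.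

Definition continuous_into {K} (tK : Topology K) {X : NormedSpace}
  (f : K -> X) : Prop :=
  forall x eps, eps > 0 ->
    exists U, is_open tK U /\ U x /\
              forall y, U y -> vnorm (vsub (f y) (f x)) < eps.

Definition vanishes_at_infinity {K} (tK : Topology K) {X : NormedSpace}
  (f : K -> X) : Prop :=
  forall eps, eps > 0 ->
    exists C, compact tK C /\ forall x, ~ C x -> vnorm (f x) < eps.

Definition C0 {K} (tK : Topology K) (X : NormedSpace) (f : K -> X) : Prop :=
  continuous_into tK f /\ vanishes_at_infinity tK f.

(* sup norm: sup_x ||f x|| (taken to be 0 when K is empty) *)
Definition supnorm {K} {X : NormedSpace} (f : K -> X) : R :=
  epsilon (inhabits 0%R)
    (fun r => is_lub (fun t => t = 0 \/ exists x, t = vnorm (f x)) r).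

Definition lincomb {K} {X : NormedSpace} (a : R) (f : K -> X) (b : R) (g : K -> X)
  : K -> X := fun x => vadd (vscal a (f x)) (vscal b (g x)).

(* isomorphic embedding C_0(K,X) -> C_0(L,Y); T is only required to behave
   on C_0(K,X) (its values elsewhere are irrelevant). *)
Definition iso_embedding_C0 {K L} (tK : Topology K) (X : NormedSpace)
  (tL : Topology L) (Y : NormedSpace) (T : (K -> X) -> (L -> Y)) : Prop :=
  (forall u, C0 tK X u -> C0 tL Y (T u)) /\
  (forall a b u v, C0 tK X u -> C0 tK X v ->
       T (lincomb a u b v) = lincomb a (T u) b (T v)) /\
  exists A B, A > 0 /\ B > 0 /\
    forall u, C0 tK X u ->
      A * supnorm u <= supnorm (T u) /\ supnorm (T u) <= B * supnorm u.

Definition c0 (u : nat -> R) : Prop := C0 (discrete_topology nat) R_NS u.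

Definition iso_embedding_c0 (X : NormedSpace) (T : (nat -> R) -> X) : Prop :=
  (forall a b u v, c0 u -> c0 v ->
       T (lincomb (X := R_NS) a u b v) = vadd (vscal a (T u)) (vscal b (T v))) /\
  exists A B, A > 0 /\ B > 0 /\
    forall u, c0 u ->
      A * supnorm (X := R_NS) u <= vnorm (T u) /\
      vnorm (T u) <= B * supnorm (X := R_NS) u.

Definition contains_c0 (X : NormedSpace) : Prop :=
  exists T, iso_embedding_c0 X T.

(* Main.v *)
(* Suppose [K] is not scattered. A subset of [K] without isolated points carries a
   dyadic tree of functions [f_s], where siblings are disjoint and [f_s = 1] on the
   supports of its children. For fixed [y] the operator [u |-> T u y] cannot be
   bounded below on a disjoint sequence of such functions, since it would then fix a
   copy of [c_0] (James' blocking argument). Hence below every node there is a node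
   past which [T f_t y] stays small. As [L] is scattered, the countable family
   [T f_s] takes only countably many values [(T f_s y)_s], so a diagonal argument
   gives a branch along which [T f_s] tends to 0 pointwise on [L]. Scatteredness of
   [L] again yields convex combinations of these that are uniformly small, whereas
   the same convex combinations of the [f_s] have norm 1. *)
From Stdlib Require Import Reals Lra Lia List Classical ClassicalEpsilon Compare_dec.
From Stdlib Require Import FunctionalExtensionality PropExtensionality.
From Stdlib Require Cantor.
Require Import Defs.
Import ListNotations.
Open Scope R_scope.

(** * Topology *)

Section Topology.
Context {T : Type} (t : Topology T).

(** The space [L] may be uncountable, so the branch cannot be found by diagonalising over its
    points; what is diagonalised is a countable list of value families, each paired with a
    precision. Mazur's theorem would normally call for weak nullness, hence for the dual of
    $C_0(L)$. Here the norms $\|T f_s(y)\|$ are treated instead as a bounded, pointwise null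
    sequence of scalar functions of [y], and an elementary averaging argument produces the convex
    combinations. Both uses of scatteredness go through one principle: a property of sets that
    passes to subsets and finite unions reaches all compact sets once, near each [y], it can be
    deduced from compact sets avoiding [y]. The tree serves two opposite purposes: nodes hanging off
    a path at different levels are disjoint, which feeds James' argument, while nodes on one branch
    are nested, so all of them equal 1 wherever the deepest one does. *)

Lemma open_local (U : T -> Prop) :
  (forall x, U x -> exists V, is_open t V /\ V x /\ forall y, V y -> U y) ->
  is_open t U.
Proof.
  intros H.
  replace U with (fun x => exists V, (is_open t V /\ forall y, V y -> U y) /\ V x).
  - apply open_union. intros V [HV _]. exact HV.
  - apply functional_extensionality; intros x; apply propositional_extensionality.
    split.
    + intros [V [[_ HV] Vx]]. auto.
    + intros Ux. destruct (H x Ux) as [V [HV [Vx VU]]]. exists V; auto.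
Qed.

Lemma open_or (U V : T -> Prop) :
  is_open t U -> is_open t V -> is_open t (fun x => U x \/ V x).
Proof.
  intros HU HV. apply open_local. intros x [Ux|Vx]; [exists U|exists V]; auto.
Qed.

Lemma open_empty : is_open t (fun _ => False).
Proof. apply open_local. intros x []. Qed.

(** Most finite-subcover arguments below go through this principle: the open sets with [P] cover
    [C], and the sets with [P] form an ideal that absorbs the finite union. *)
Lemma compact_ind (C : T -> Prop) (P : (T -> Prop) -> Prop) :
  compact t C ->
  P (fun _ => False) ->
  (forall D E : T -> Prop, (forall x, D x -> E x) -> P E -> P D) ->
  (forall D E, P D -> P E -> P (fun x => D x \/ E x)) ->
  (forall x, C x -> exists U, is_open t U /\ U x /\ P U) ->
  P C.
Proof.
  intros HC P0 Pmono PU Ploc.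
  destruct (HC (fun U => is_open t U /\ P U)) as [l [Hl Cl]].
  - intros U [HU _]; exact HU.
  - intros x Cx. destruct (Ploc x Cx) as [U [HU [Ux PUx]]]. exists U; auto.
  - apply Pmono with (fun x => exists U, In U l /\ U x); [exact Cl|].
    clear Cl. induction Hl as [|U l [_ HU] _ IH].
    + apply Pmono with (fun _ => False); [|exact P0]. intros x [U [[] _]].
    + apply Pmono with (fun x => U x \/ exists V, In V l /\ V x); [|auto].
      intros x [V [[<-|HV] Vx]]; [left; exact Vx|right; exists V; auto].
Qed.

Lemma compact_minus_open (C V : T -> Prop) :
  compact t C -> is_open t V -> compact t (fun x => C x /\ ~ V x).
Proof.
  intros HC HV F HF Fcov.
  assert (H : exists l, Forall F l /\
            forall x, C x -> ~ V x -> exists U, In U l /\ U x).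
  { apply (compact_ind C (fun D => exists l, Forall F l /\
            forall x, D x -> ~ V x -> exists U, In U l /\ U x) HC).
    - exists nil. split; [constructor|]. intros x [].
    - intros D E DE [l [Hl El]]. exists l; auto.
    - intros D E [l [Hl Dl]] [m [Hm Em]]. exists (l ++ m). split.
      + apply Forall_app; auto.
      + intros x [Dx|Ex] nV;
          [destruct (Dl x Dx nV) as [U [HU Ux]]|destruct (Em x Ex nV) as [U [HU Ux]]];
          exists U; split; auto; apply in_or_app; auto.
    - intros x Cx. destruct (classic (V x)) as [Vx|nVx].
      + exists V. split; [exact HV|split; [exact Vx|]].
        exists nil. split; [constructor|]. intros y Vy nVy; contradiction.
      + destruct (Fcov x (conj Cx nVx)) as [U [FU Ux]].
        exists U. split; [auto|split; [exact Ux|]].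
        exists [U]. split; [auto|]. intros y Uy _. exists U; simpl; auto. }
  destruct H as [l [Hl Cl]]. exists l. split; [exact Hl|].
  intros x [Cx nV]; auto.
Qed.

Lemma compact_or (C D : T -> Prop) :
  compact t C -> compact t D -> compact t (fun x => C x \/ D x).
Proof.
  intros HC HD F HF Fcov.
  destruct (HC F HF) as [l [Hl Cl]]; [auto|].
  destruct (HD F HF) as [m [Hm Dm]]; [auto|].
  exists (l ++ m). split; [apply Forall_app; auto|].
  intros x [Cx|Dx];
    [destruct (Cl x Cx) as [U [HU Ux]]|destruct (Dm x Dx) as [U [HU Ux]]];
    exists U; split; auto; apply in_or_app; auto.
Qed.

Lemma compact_empty : compact t (fun _ => False).
Proof. intros F _ _. exists nil. split; [constructor|]. intros x []. Qed.

Lemma separate_point_compact (C : T -> Prop) x :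
  hausdorff t -> compact t C -> ~ C x ->
  exists U V, is_open t U /\ is_open t V /\ U x /\ (forall y, C y -> V y) /\
              (forall z, U z -> V z -> False).
Proof.
  intros HT HC nCx.
  apply (compact_ind C (fun D => exists U V, is_open t U /\ is_open t V /\ U x /\
            (forall y, D y -> V y) /\ (forall z, U z -> V z -> False)) HC).
  - exists (fun _ => True), (fun _ => False).
    split; [apply open_full|]. split; [apply open_empty|]. auto.
  - intros D E DE [U [V [HU [HV [Ux [EV UV]]]]]]. exists U, V. auto 10.
  - intros D E [U [V [HU [HV [Ux [DV UV]]]]]] [U' [V' [HU' [HV' [Ux' [EV' UV']]]]]].
    exists (fun y => U y /\ U' y), (fun y => V y \/ V' y).
    split; [apply open_inter; auto|]. split; [apply open_or; auto|].
    split; [auto|]. split.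
    + intros y [Dy|Ey]; auto.
    + intros z [Uz Uz'] [Vz|Vz']; eauto.
  - intros y Cy.
    destruct (HT x y) as [U [V [HU [HV [Ux [Vy UV]]]]]]; [congruence|].
    exists V. split; [auto|]. split; [auto|]. exists U, V. auto 10.
Qed.

Lemma compact_compl_open (C : T -> Prop) :
  hausdorff t -> compact t C -> is_open t (fun x => ~ C x).
Proof.
  intros HT HC. apply open_local. intros x nCx.
  destruct (separate_point_compact C x HT HC nCx) as [U [V [HU [_ [Ux [CV UV]]]]]].
  exists U. split; [auto|]. split; [auto|]. intros y Uy Cy. eauto.
Qed.

(** Relative compactness of [D] in [U], witnessed by a compact set in between so that closures never
    have to be formed. *)
Definition inside (D U : T -> Prop) : Prop :=
  exists C, compact t C /\ (forall x, D x -> C x) /\ (forall x, C x -> U x).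

(** In a compact neighbourhood [Q] of [x], the part of [Q] outside [U] is compact and misses [x].
    Separating it from [x] by an open [W] leaves the compact set [Q] minus [W], which lies in
    [U]. *)
Lemma lch_shrink (U : T -> Prop) x :
  lch t -> is_open t U -> U x -> exists V, is_open t V /\ V x /\ inside V U.
Proof.
  intros [LC HT] HU Ux. destruct (LC x) as [O [Q [HO [Ox [HQ OQ]]]]].
  pose proof (compact_minus_open Q U HQ HU) as HQU.
  destruct (separate_point_compact _ x HT HQU) as [V [W [HV [HW [Vx [QW VW]]]]]];
    [tauto|].
  exists (fun y => O y /\ V y). split; [apply open_inter; auto|]. split; [auto|].
  exists (fun y => Q y /\ ~ W y). split; [apply compact_minus_open; auto|]. split.
  - intros y [Oy Vy]. split; [auto|]. intros Wy. eauto.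
  - intros y [Qy nWy]. apply NNPP. intros nUy. apply nWy, QW. auto.
Qed.

Lemma inside_interpolate (D U : T -> Prop) :
  lch t -> is_open t U -> inside D U ->
  exists W, is_open t W /\ inside D W /\ inside W U.
Proof.
  intros LT HU [C [HC [DC CU]]].
  assert (H : exists W, is_open t W /\ (forall x, C x -> W x) /\ inside W U).
  { apply (compact_ind C (fun E => exists W, is_open t W /\
              (forall x, E x -> W x) /\ inside W U) HC).
    - exists (fun _ => False). split; [apply open_empty|]. split; [auto|].
      exists (fun _ => False). split; [apply compact_empty|]. tauto.
    - intros E F EF [W [HW [FW WU]]]. exists W. auto.
    - intros E F [W [HW [EW [Q [HQ [WQ QU]]]]]] [W' [HW' [FW' [Q' [HQ' [WQ' QU']]]]]].
      exists (fun x => W x \/ W' x). split; [apply open_or; auto|].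
      split; [intros x [Ex|Fx]; auto|].
      exists (fun x => Q x \/ Q' x). split; [apply compact_or; auto|].
      split; intros x [a|a]; auto.
    - intros x Cx. destruct (lch_shrink U x LT HU (CU x Cx)) as [V [HV [Vx VU]]].
      exists V. split; [auto|]. split; [auto|]. exists V; auto. }
  destruct H as [W [HW [CW WU]]]. exists W. split; [auto|]. split; [|auto].
  exists C; auto.
Qed.

(* The union [W] of all open sets satisfying [P] is everything: otherwise an
   isolated point of its complement would have a neighbourhood satisfying [P]. *)
Lemma scattered_ind (P : (T -> Prop) -> Prop) :
  scattered t ->
  P (fun _ => False) ->
  (forall D E : T -> Prop, (forall x, D x -> E x) -> P E -> P D) ->
  (forall D E, P D -> P E -> P (fun x => D x \/ E x)) ->
  (forall y U, is_open t U -> U y ->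
     (forall C, compact t C -> (forall x, C x -> U x) -> ~ C y -> P C) ->
     exists V, is_open t V /\ V y /\ P V) ->
  forall C, compact t C -> P C.
Proof.
  intros SC P0 Pmono PU Pstep.
  set (W := fun x => exists U, is_open t U /\ U x /\ P U).
  assert (HW : forall x, W x).
  { intros x. apply NNPP. intros nWx.
    destruct (SC (fun x => ~ W x)) as [y [nWy [U [HU [Uy Uiso]]]]]; [eauto|].
    apply nWy. apply (Pstep y U HU Uy).
    (* Every point of [U] other than [y] lies in [W], so a compact subset of [U] missing [y] is
       covered by open sets with [P]. *)
    intros C HC CU nCy.
    apply (compact_ind C P HC P0 Pmono PU).
    intros z Cz. apply NNPP. intros nWz.
    assert (z = y) by (apply Uiso; auto). subst z. contradiction. }
  intros C HC. apply (compact_ind C P HC P0 Pmono PU).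
  intros x _. apply HW.
Qed.

End Topology.

(** * Bump functions on locally compact Hausdorff spaces *)

Definition indic {T} (U : T -> Prop) (x : T) : R :=
  if excluded_middle_informative (U x) then 1 else 0.

Section Urysohn.
Context {T : Type} (t : Topology T) (LT : lch t).

Record gap := {
  gap_in : T -> Prop;
  gap_out : T -> Prop;
  gap_in_open : is_open t gap_in;
  gap_out_open : is_open t gap_out;
  gap_inside : inside t gap_in gap_out
}.

Lemma gap_split (p : gap) :
  exists q : gap * gap, gap_in (fst q) = gap_in p /\
    gap_out (fst q) = gap_in (snd q) /\ gap_out (snd q) = gap_out p.
Proof.
  destruct p as [V U HV HU VU].
  destruct (inside_interpolate t V U LT HU VU) as [W [HW [VW WU]]].
  exists (Build_gap V W HV HW VW, Build_gap W U HW HU WU). auto.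
Qed.

Definition halves (p : gap) : gap * gap :=
  proj1_sig (constructive_indefinite_description _ (gap_split p)).

(* Repeated splitting of the gap [V << U] gives a chain
   [V = W_0 << ... << W_N = U] with [N = 2^n]; [lower n] and [upper n] are the
   averages of the indicators of [W_0 .. W_(N-1)] and of [W_1 .. W_N]. *)
Fixpoint lower (n : nat) (p : gap) (x : T) : R :=
  match n with
  | O => indic (gap_in p) x
  | S n => (lower n (fst (halves p)) x + lower n (snd (halves p)) x) / 2
  end.

Fixpoint upper (n : nat) (p : gap) (x : T) : R :=
  match n with
  | O => indic (gap_out p) x
  | S n => (upper n (fst (halves p)) x + upper n (snd (halves p)) x) / 2
  end.

Lemma halves_spec p :
  gap_in (fst (halves p)) = gap_in p /\
  gap_out (fst (halves p)) = gap_in (snd (halves p)) /\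
  gap_out (snd (halves p)) = gap_out p.
Proof. unfold halves. exact (proj2_sig (constructive_indefinite_description _ (gap_split p))). Qed.

Lemma gap_incl p x : gap_in p x -> gap_out p x.
Proof. destruct (gap_inside p) as [C [_ [H1 H2]]]. auto. Qed.

Lemma halves_in p x : gap_in p x ->
  gap_in (fst (halves p)) x /\ gap_in (snd (halves p)) x.
Proof.
  destruct (halves_spec p) as [H1 [H2 H3]]. intros Hx.
  rewrite H1, <- H2. split; [auto|]. apply gap_incl. rewrite H1; auto.
Qed.

Lemma halves_out p x : ~ gap_out p x ->
  ~ gap_out (fst (halves p)) x /\ ~ gap_out (snd (halves p)) x.
Proof.
  destruct (halves_spec p) as [H1 [H2 H3]]. intros Hx.
  rewrite H3, H2. split; [|auto]. intros Hin. apply gap_incl in Hin.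
  rewrite H3 in Hin. auto.
Qed.

Lemma lower_upper_range n p x :
  0 <= lower n p x <= 1 /\ 0 <= upper n p x <= 1.
Proof.
  revert p; induction n; intros p; simpl.
  - unfold indic. destruct excluded_middle_informative; destruct excluded_middle_informative; lra.
  - pose proof (IHn (fst (halves p))). pose proof (IHn (snd (halves p))). lra.
Qed.

Lemma lower_upper_in n p x : gap_in p x -> lower n p x = 1 /\ upper n p x = 1.
Proof.
  revert p; induction n; intros p Hx; simpl.
  - pose proof (gap_incl p x Hx).
    unfold indic. destruct excluded_middle_informative; destruct excluded_middle_informative; tauto.
  - destruct (halves_in p x Hx) as [H1 H2].
    destruct (IHn _ H1) as [-> ->]. destruct (IHn _ H2) as [-> ->]. lra.
Qed.

Lemma lower_upper_out n p x : ~ gap_out p x -> lower n p x = 0 /\ upper n p x = 0.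
Proof.
  revert p; induction n; intros p Hx; simpl.
  - assert (~ gap_in p x) by (intros H; apply Hx, gap_incl, H).
    unfold indic. destruct excluded_middle_informative; destruct excluded_middle_informative; tauto.
  - destruct (halves_out p x Hx) as [H1 H2].
    destruct (IHn _ H1) as [-> ->]. destruct (IHn _ H2) as [-> ->]. lra.
Qed.

(** The depths are independent because the limit function is a supremum of all [lower m] and must
    stay below every [upper n]. At depth 0 the bound is trivial where the indicator is extreme in
    the right direction, and elsewhere the other average is pinned to 0 or 1. *)
Lemma lower_le_upper m n p x : lower m p x <= upper n p x.
Proof.
  revert m p; induction n; intros m p.
  - destruct (classic (gap_out p x)) as [H|H].
    + pose proof (lower_upper_range m p x). simpl. unfold indic.
      destruct excluded_middle_informative; [lra|tauto].
    + destruct (lower_upper_out m p x H) as [-> _].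
      pose proof (lower_upper_range 0 p x). lra.
  - destruct m.
    + destruct (classic (gap_in p x)) as [H|H].
      * destruct (lower_upper_in (S n) p x H) as [_ ->].
        pose proof (lower_upper_range 0 p x). lra.
      * pose proof (lower_upper_range (S n) p x).
        change (lower 0 p x) with (indic (gap_in p) x). unfold indic.
        destruct excluded_middle_informative; [tauto|lra].
    + simpl. pose proof (IHn m (fst (halves p))). pose proof (IHn m (snd (halves p))). lra.
Qed.

(* At each point only one of the two halves contributes to [upper - lower]. *)
Lemma upper_le_lower n p x : upper n p x <= lower n p x + (1/2) ^ n.
Proof.
  revert p; induction n; intros p.
  - pose proof (lower_upper_range 0 p x). change ((1/2)^0) with 1. lra.
  - change ((1/2)^(S n)) with (1/2 * (1/2)^n). simpl.
    destruct (halves_spec p) as [H1 [H2 H3]].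
    pose proof (IHn (fst (halves p))). pose proof (IHn (snd (halves p))).
    destruct (classic (gap_in (snd (halves p)) x)) as [Hs|Hs].
    + destruct (lower_upper_in n _ x Hs) as [-> ->]. lra.
    + rewrite <- H2 in Hs. destruct (lower_upper_out n _ x Hs) as [-> ->]. lra.
Qed.

(** At depth 0, openness of [gap_in] gives the lower bound. For the upper one, a point outside
    [gap_out] has the complement of the intermediate compact set as a neighbourhood, and [gap_in]
    does not meet it. Averaging preserves both bounds. *)
Lemma lower_near n p x :
  exists O, is_open t O /\ O x /\
    forall y, O y -> lower n p x <= lower n p y <= upper n p x.
Proof.
  revert p; induction n; intros p.
  - assert (H1 : exists O, is_open t O /\ O x /\
                 forall y, O y -> indic (gap_in p) x <= indic (gap_in p) y).
    { destruct (classic (gap_in p x)) as [H|H].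
      - exists (gap_in p). split; [apply gap_in_open|]. split; [auto|]. intros y Hy.
        unfold indic.
        do 2 destruct excluded_middle_informative; try lra; tauto.
      - exists (fun _ => True). split; [apply open_full|]. split; [auto|]. intros y Hy.
        unfold indic.
        do 2 destruct excluded_middle_informative; try lra; tauto. }
    assert (H2 : exists O, is_open t O /\ O x /\
                 forall y, O y -> indic (gap_in p) y <= indic (gap_out p) x).
    { destruct (classic (gap_out p x)) as [H|H].
      - exists (fun _ => True). split; [apply open_full|]. split; [auto|]. intros y Hy.
        unfold indic.
        do 2 destruct excluded_middle_informative; try lra; tauto.
      - destruct (gap_inside p) as [C [HC [VC CU]]].
        exists (fun y => ~ C y). split; [apply compact_compl_open; [apply LT|auto]|].
        split; [auto|]. intros y Hy.
        unfold indic.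
        destruct excluded_middle_informative; destruct excluded_middle_informative; try lra.
        exfalso; auto. }
    destruct H1 as [O [HO [Ox H1]]], H2 as [O' [HO' [Ox' H2]]].
    exists (fun y => O y /\ O' y). split; [apply open_inter; auto|]. split; [auto|].
    intros y [Oy Oy']. simpl. auto.
  - destruct (IHn (fst (halves p))) as [O [HO [Ox H1]]].
    destruct (IHn (snd (halves p))) as [O' [HO' [Ox' H2]]].
    exists (fun y => O y /\ O' y). split; [apply open_inter; auto|]. split; [auto|].
    intros y [Oy Oy']. specialize (H1 y Oy). specialize (H2 y Oy'). simpl. lra.
Qed.

Lemma urysohn (V U : T -> Prop) :
  is_open t V -> is_open t U -> inside t V U ->
  exists f : T -> R,
    (forall x eps, eps > 0 -> exists O, is_open t O /\ O x /\
        forall y, O y -> Rabs (f y - f x) < eps) /\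
    (forall x, 0 <= f x <= 1) /\
    (forall x, V x -> f x = 1) /\ (forall x, ~ U x -> f x = 0).
Proof.
  intros HV HU VU. set (p := Build_gap V U HV HU VU).
  assert (H : forall x, exists r, forall n, lower n p x <= r <= upper n p x).
  { intros x.
    destruct (completeness (fun r => exists n, r = lower n p x)) as [r [Hr1 Hr2]].
    - exists 1. intros r [n ->]. apply (lower_upper_range n p x).
    - eexists; exists 0%nat; reflexivity.
    - exists r. intros n. split.
      + apply Hr1. eauto.
      + apply Hr2. intros q [m ->]. apply lower_le_upper. }
  set (f := fun x => proj1_sig (constructive_indefinite_description _ (H x))).
  assert (Hf : forall x n, lower n p x <= f x <= upper n p x).
  { intros x. unfold f. apply proj2_sig. }
  exists f. repeat split.
  - intros x eps Heps.
    (* With $d = 2^{-n}$, the chain [f y <= upper y <= lower y + d <= upper x + d <= lower x + 2 d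
       <= f x + 2 d] spends [d] twice, hence [eps / 2]. *)
    destruct (pow_lt_1_zero (1/2)) with (y := eps / 2) as [n Hn];
      [rewrite Rabs_right; lra|lra|].
    specialize (Hn n (le_n n)). rewrite Rabs_right in Hn;
      [|apply Rle_ge, pow_le; lra].
    destruct (lower_near n p x) as [O [HO [Ox HOy]]].
    exists O. split; [auto|]. split; [auto|]. intros y Oy. specialize (HOy y Oy).
    pose proof (Hf x n). pose proof (Hf y n).
    pose proof (upper_le_lower n p x). pose proof (upper_le_lower n p y).
    apply Rabs_def1; lra.
  - pose proof (Hf x 0%nat). pose proof (lower_upper_range 0 p x). lra.
  - pose proof (Hf x 0%nat). pose proof (lower_upper_range 0 p x). lra.
  - intros x Vx. pose proof (Hf x 0%nat).
    destruct (lower_upper_in 0 p x Vx) as [E1 E2]. lra.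
  - intros x Ux. pose proof (Hf x 0%nat).
    destruct (lower_upper_out 0 p x Ux) as [E1 E2]. lra.
Qed.

End Urysohn.

(** * Spaces of continuous functions vanishing at infinity *)

Section NormedSpaceFacts.
Context {X : NormedSpace}.

(** Not an axiom of [NormedSpace]: it follows from the triangle inequality for [x + (-x)] and for
    [0 + 0]. *)
Lemma vnorm_pos (x : X) : 0 <= vnorm x.
Proof.
  pose proof (vnorm_triang X x (vscal (-1) x)) as H.
  rewrite vadd_opp, vnorm_scal, Rabs_left in H by lra.
  pose proof (vnorm_scal X 0 x) as H0. pose proof (vnorm_triang X (vscal 0 x) (vscal 0 x)) as H1.
  rewrite <- vscal_distr_r in H1. rewrite (vnorm_scal X (0 + 0)), vnorm_scal in H1.
  pose proof (vnorm_triang X vzero vzero) as H2. rewrite vadd_zero in H2. lra.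
Qed.

Lemma vnorm_zero : vnorm (vzero : X) = 0.
Proof.
  assert (H : vscal 0 vzero = (vzero : X)).
  { apply vnorm_eq0. rewrite vnorm_scal, Rabs_R0. ring. }
  rewrite <- H, vnorm_scal, Rabs_R0. ring.
Qed.

Lemma vnorm_lin (a b : R) (x y : X) :
  vnorm (vadd (vscal a x) (vscal b y)) <= Rabs a * vnorm x + Rabs b * vnorm y.
Proof.
  eapply Rle_trans; [apply vnorm_triang|]. rewrite !vnorm_scal. lra.
Qed.

Lemma vnorm_lin_same (a : R) (x : X) :
  vnorm (vadd (vscal a x) (vscal 0 x)) = Rabs a * vnorm x.
Proof. rewrite <- vscal_distr_r, vnorm_scal. f_equal. f_equal. lra. Qed.

Lemma vsub_swap (x y : X) : vnorm (vsub x y) = vnorm (vsub y x).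
Proof.
  unfold vsub.
  replace (vadd x (vscal (-1) y)) with (vscal (-1) (vadd y (vscal (-1) x))).
  - rewrite vnorm_scal, Rabs_left; lra.
  - rewrite vscal_distr_l, vscal_assoc.
    replace (-1 * -1) with 1 by lra. rewrite vscal_one. apply vadd_comm.
Qed.

Lemma vsub_add (x y : X) : vadd (vsub x y) y = x.
Proof.
  unfold vsub. rewrite <- vadd_assoc, (vadd_comm _ _ y), vadd_opp. apply vadd_zero.
Qed.

Lemma vnorm_le_sub (x y : X) : vnorm x <= vnorm y + vnorm (vsub x y).
Proof.
  rewrite <- (vsub_add x y) at 1. rewrite Rplus_comm. apply vnorm_triang.
Qed.

Lemma vnorm_sub_abs (x y : X) : Rabs (vnorm x - vnorm y) <= vnorm (vsub x y).
Proof.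
  pose proof (vnorm_le_sub x y). pose proof (vnorm_le_sub y x).
  rewrite (vsub_swap y x) in *. apply Rabs_le. lra.
Qed.

Lemma vsub_eq0 (x y : X) : vnorm (vsub x y) = 0 -> x = y.
Proof.
  intros H. apply vnorm_eq0 in H. rewrite <- (vsub_add x y), H, vadd_comm. apply vadd_zero.
Qed.

End NormedSpaceFacts.

Section C0Facts.
Context {K : Type} (tK : Topology K).

Lemma C0_R_NS (f : K -> R) :
  C0 tK R_NS f <->
  (forall x eps, eps > 0 -> exists O, is_open tK O /\ O x /\
     forall y, O y -> Rabs (f y - f x) < eps) /\
  (forall eps, eps > 0 -> exists C, compact tK C /\ forall x, ~ C x -> Rabs (f x) < eps).
Proof.
  assert (E : forall a b : R, @vnorm R_NS (@vsub R_NS a b) = Rabs (a - b)).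
  { intros a b. unfold vsub; simpl. f_equal; lra. }
  unfold C0, continuous_into, vanishes_at_infinity.
  split; intros [H1 H2]; (split; [|exact H2]); intros x eps He;
    destruct (H1 x eps He) as [O [HO [Ox Hy]]]; exists O; (split; [auto|]; split; [auto|]);
    intros y Oy; specialize (Hy y Oy).
  - rewrite <- E. exact Hy.
  - rewrite E. exact Hy.
Qed.

Lemma C0_norm {X : NormedSpace} (f : K -> X) :
  C0 tK X f -> C0 tK R_NS (fun x => vnorm (f x)).
Proof.
  intros [Hc Hv]. apply C0_R_NS. split.
  - intros x eps He. destruct (Hc x eps He) as [O [HO [Ox Hy]]].
    exists O. split; [auto|]. split; [auto|]. intros y Oy.
    eapply Rle_lt_trans; [apply vnorm_sub_abs|auto].
  - intros eps He. destruct (Hv eps He) as [C [HC Hx]]. exists C. split; [auto|].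
    intros x nCx. rewrite Rabs_right; [auto|]. apply Rle_ge, vnorm_pos.
Qed.

Lemma C0_lincomb (a b : R) (f g : K -> R) :
  C0 tK R_NS f -> C0 tK R_NS g -> C0 tK R_NS (fun x => a * f x + b * g x).
Proof.
  rewrite !C0_R_NS. intros [Hf Vf] [Hg Vg].
  set (M := Rabs a + Rabs b + 1).
  assert (HM : M > 0) by (unfold M; pose proof (Rabs_pos a); pose proof (Rabs_pos b); lra).
  assert (Hlin : forall eps u v, eps > 0 -> Rabs u < eps / M -> Rabs v < eps / M ->
             Rabs (a * u + b * v) < eps).
  { intros eps u v He Hu Hv. eapply Rle_lt_trans; [apply Rabs_triang|].
    rewrite !Rabs_mult.
    assert (Rabs a * Rabs u <= Rabs a * (eps / M))
      by (apply Rmult_le_compat_l; [apply Rabs_pos|lra]).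
    assert (Rabs b * Rabs v <= Rabs b * (eps / M))
      by (apply Rmult_le_compat_l; [apply Rabs_pos|lra]).
    assert (E : eps = M * (eps / M)) by (field; lra).
    assert (0 < eps / M) by (apply Rdiv_lt_0_compat; lra).
    rewrite E at 1. unfold M at 1. lra. }
  split.
  - intros x eps He.
    assert (0 < eps / M) by (apply Rdiv_lt_0_compat; lra).
    destruct (Hf x (eps / M)) as [O [HO [Ox Hy]]]; [lra|].
    destruct (Hg x (eps / M)) as [O' [HO' [Ox' Hy']]]; [lra|].
    exists (fun y => O y /\ O' y). split; [apply open_inter; auto|]. split; [auto|].
    intros y [Oy Oy'].
    replace (a * f y + b * g y - (a * f x + b * g x))
      with (a * (f y - f x) + b * (g y - g x)) by ring. auto.
  - intros eps He.
    assert (0 < eps / M) by (apply Rdiv_lt_0_compat; lra).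
    destruct (Vf (eps / M)) as [C [HC Hx]]; [lra|].
    destruct (Vg (eps / M)) as [C' [HC' Hx']]; [lra|].
    exists (fun y => C y \/ C' y). split; [apply compact_or; auto|].
    intros x nC. apply Hlin; auto.
Qed.

Lemma C0_uniform_limit (f : K -> R) :
  (forall eps, eps > 0 -> exists g, C0 tK R_NS g /\ forall x, Rabs (f x - g x) < eps) ->
  C0 tK R_NS f.
Proof.
  intros H. apply C0_R_NS. split.
  - intros x eps He. destruct (H (eps / 3)) as [g [Hg Hfg]]; [lra|].
    apply C0_R_NS in Hg. destruct Hg as [Hg _].
    destruct (Hg x (eps / 3)) as [O [HO [Ox Hy]]]; [lra|].
    exists O. split; [auto|]. split; [auto|]. intros y Oy. specialize (Hy y Oy).
    pose proof (Hfg x) as Hx. pose proof (Hfg y) as Hy'.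
    apply Rabs_def2 in Hx, Hy', Hy. apply Rabs_def1; lra.
  - intros eps He. destruct (H (eps / 2)) as [g [Hg Hfg]]; [lra|].
    apply C0_R_NS in Hg. destruct Hg as [_ Hg].
    destruct (Hg (eps / 2)) as [C [HC Hx]]; [lra|].
    exists C. split; [auto|]. intros x nCx. specialize (Hx x nCx). specialize (Hfg x).
    apply Rabs_def2 in Hx, Hfg. apply Rabs_def1; lra.
Qed.

Lemma C0_superlevel_compact {X : NormedSpace} (f : K -> X) (eps : R) (C : K -> Prop) :
  C0 tK X f -> compact tK C -> compact tK (fun x => C x /\ vnorm (f x) >= eps).
Proof.
  intros Hf HC.
  replace (fun x => C x /\ vnorm (f x) >= eps) with (fun x => C x /\ ~ vnorm (f x) < eps).
  - apply compact_minus_open; [auto|]. apply open_local. intros x Hx.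
    apply C0_norm, C0_R_NS in Hf. destruct Hf as [Hc _].
    destruct (Hc x (eps - vnorm (f x))) as [O [HO [Ox Hy]]]; [lra|].
    exists O. split; [auto|]. split; [auto|]. intros y Oy. specialize (Hy y Oy).
    apply Rabs_def2 in Hy. lra.
  - apply functional_extensionality; intros x. apply propositional_extensionality.
    split; intros [H1 H2]; split; auto; lra.
Qed.

Lemma C0_bounded {X : NormedSpace} (f : K -> X) :
  C0 tK X f -> exists M, forall x, vnorm (f x) <= M.
Proof.
  intros Hf. destruct (proj2 Hf 1) as [C [HC Hx]]; [lra|].
  assert (H : exists M, forall x, C x -> vnorm (f x) <= M).
  { apply (compact_ind tK C (fun D => exists M, forall x, D x -> vnorm (f x) <= M) HC).
    - exists 0. tauto.
    - intros D E DE [M HM]. exists M. auto.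
    - intros D E [M HM] [M' HM']. exists (Rmax M M').
      pose proof (Rmax_l M M'). pose proof (Rmax_r M M').
      intros x [Dx|Ex]; [specialize (HM x Dx)|specialize (HM' x Ex)]; lra.
    - intros x _. destruct (proj1 Hf x 1) as [O [HO [Ox Hy]]]; [lra|].
      exists O. split; [auto|]. split; [auto|]. exists (vnorm (f x) + 1).
      intros y Oy. specialize (Hy y Oy). pose proof (vnorm_le_sub (f y) (f x)). lra. }
  destruct H as [M HM]. exists (Rmax M 1). intros x.
  pose proof (Rmax_l M 1). pose proof (Rmax_r M 1).
  destruct (classic (C x)) as [Cx|nCx]; [specialize (HM x Cx)|specialize (Hx x nCx)]; lra.
Qed.

Lemma supnorm_lub {X : NormedSpace} (f : K -> X) :
  C0 tK X f -> is_lub (fun r => r = 0 \/ exists x, r = vnorm (f x)) (supnorm f).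
Proof.
  intros Hf. unfold supnorm. apply epsilon_spec. destruct (C0_bounded f Hf) as [M HM].
  destruct (completeness (fun r => r = 0 \/ exists x, r = vnorm (f x))) as [m Hm].
  - exists (Rmax M 0). pose proof (Rmax_l M 0). pose proof (Rmax_r M 0).
    intros r [->|[x ->]]; [lra|]. specialize (HM x). lra.
  - exists 0. auto.
  - exists m. exact Hm.
Qed.

Lemma supnorm_ge {X : NormedSpace} (f : K -> X) x : C0 tK X f -> vnorm (f x) <= supnorm f.
Proof. intros Hf. apply (supnorm_lub f Hf). eauto. Qed.

Lemma supnorm_ge0 {X : NormedSpace} (f : K -> X) : C0 tK X f -> 0 <= supnorm f.
Proof. intros Hf. apply (supnorm_lub f Hf). auto. Qed.

Lemma supnorm_le {X : NormedSpace} (f : K -> X) M :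
  C0 tK X f -> 0 <= M -> (forall x, vnorm (f x) <= M) -> supnorm f <= M.
Proof.
  intros Hf HM H. apply (supnorm_lub f Hf). intros r [->|[x ->]]; auto.
Qed.

End C0Facts.

Lemma compact_discrete_nat_bounded (C : nat -> Prop) :
  compact (discrete_topology nat) C -> exists N, forall n, C n -> (n < N)%nat.
Proof.
  intros HC.
  apply (compact_ind _ C (fun D => exists N, forall n, D n -> (n < N)%nat) HC).
  - exists 0%nat. tauto.
  - intros D E DE [N HN]. exists N. auto.
  - intros D E [N HN] [M HM]. exists (N + M)%nat.
    intros n [Dn|En]; [specialize (HN n Dn)|specialize (HM n En)]; lia.
  - intros n _. exists (fun m => m = n). split; [exact I|]. split; [auto|].
    exists (S n). intros m ->. lia.
Qed.

Lemma compact_discrete_nat_lt (N : nat) :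
  compact (discrete_topology nat) (fun n => (n < N)%nat).
Proof.
  induction N as [|N IH].
  - replace (fun n => (n < 0)%nat) with (fun _ : nat => False); [apply compact_empty|].
    apply functional_extensionality; intros n. apply propositional_extensionality. lia.
  - replace (fun n => (n < S N)%nat) with (fun n => (n < N)%nat \/ n = N).
    + apply compact_or; [exact IH|]. intros F HF Fcov.
      destruct (Fcov N eq_refl) as [U [FU UN]]. exists [U]. split; [auto|].
      intros n ->. exists U. simpl; auto.
    + apply functional_extensionality; intros n. apply propositional_extensionality. lia.
Qed.

Lemma c0_iff (u : nat -> R) :
  c0 u <-> forall eps, eps > 0 -> exists N, forall n, (n >= N)%nat -> Rabs (u n) < eps.
Proof.
  unfold c0. rewrite C0_R_NS. split.
  - intros [_ H] eps He. destruct (H eps He) as [C [HC Hx]].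
    destruct (compact_discrete_nat_bounded C HC) as [N HN]. exists N.
    intros n Hn. apply Hx. intros Cn. specialize (HN n Cn). lia.
  - intros H. split.
    + intros n eps He. exists (fun m => m = n). split; [exact I|]. split; [auto|].
      intros m ->. rewrite Rminus_diag, Rabs_R0. lra.
    + intros eps He. destruct (H eps He) as [N HN].
      exists (fun n => (n < N)%nat). split; [apply compact_discrete_nat_lt|].
      intros n Hn. apply HN. lia.
Qed.

(** * Operators that are large on a disjoint sequence *)

Section Disjoint.
Context {K : Type} (tK : Topology K) (g : nat -> K -> R).
Context (g_C0 : forall k, C0 tK R_NS (g k)).
Context (g_le1 : forall k x, Rabs (g k x) <= 1).
Context (g_disjoint : forall j k x, g j x <> 0 -> g k x <> 0 -> j = k).

(* The sum of the series [c k * g k], which has at most one nonzero term at each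
   point. *)
Definition disjoint_sum (c : nat -> R) (x : K) : R :=
  let k := epsilon (inhabits 0%nat) (fun k => g k x <> 0) in c k * g k x.

Lemma disjoint_sum_at c k x : g k x <> 0 -> disjoint_sum c x = c k * g k x.
Proof.
  intros Hk. unfold disjoint_sum.
  assert (H : g (epsilon (inhabits 0%nat) (fun k => g k x <> 0)) x <> 0).
  { apply epsilon_spec. eauto. }
  rewrite (g_disjoint _ _ _ H Hk). reflexivity.
Qed.

Lemma disjoint_sum_off c x : (forall k, g k x = 0) -> disjoint_sum c x = 0.
Proof. intros H. unfold disjoint_sum. rewrite H. ring. Qed.

Lemma disjoint_sum_lin a b c d x :
  disjoint_sum (fun k => a * c k + b * d k) x
  = a * disjoint_sum c x + b * disjoint_sum d x.
Proof. unfold disjoint_sum. ring. Qed.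

Lemma disjoint_sum_unit m :
  disjoint_sum (fun k => if Nat.eq_dec k m then 1 else 0) = g m.
Proof.
  apply functional_extensionality. intros x.
  destruct (classic (exists k, g k x <> 0)) as [[k Hk]|H].
  - rewrite (disjoint_sum_at _ k x Hk). destruct (Nat.eq_dec k m) as [->|n]; [ring|].
    destruct (Req_dec (g m x) 0) as [E|E]; [rewrite E; ring|].
    elim n. eauto.
  - assert (H0 : forall k, g k x = 0) by (intros k; apply NNPP; eauto).
    rewrite disjoint_sum_off, H0; auto.
Qed.

Lemma disjoint_sum_bound c M x : (forall k, Rabs (c k) <= M) -> Rabs (disjoint_sum c x) <= M.
Proof.
  intros Hc. unfold disjoint_sum. set (k := epsilon _ _).
  rewrite Rabs_mult. pose proof (Hc k). pose proof (g_le1 k x).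
  pose proof (Rabs_pos (c k)). pose proof (Rabs_pos (g k x)). nra.
Qed.

(** Only one term is active at each point, so cutting [c] off at [N] changes the sum uniformly by at
    most the size of the tail of [c]; the cut-off sums are finite combinations of the [g k]. *)
Lemma disjoint_sum_C0 c : c0 c -> C0 tK R_NS (disjoint_sum c).
Proof.
  intros Hc. apply C0_uniform_limit. intros eps He.
  destruct (proj1 (c0_iff c) Hc eps He) as [N HN].
  assert (Hfin : forall n, C0 tK R_NS
            (disjoint_sum (fun k => if lt_dec k n then c k else 0))).
  { induction n as [|n IH].
    - replace (disjoint_sum _) with (fun x => 0 * g 0%nat x + 0 * g 0%nat x);
        [apply C0_lincomb; auto|].
      apply functional_extensionality; intros x. unfold disjoint_sum.
      destruct lt_dec; [lia|ring].
    - replace (disjoint_sum _) with (fun x =>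
        1 * disjoint_sum (fun k => if lt_dec k n then c k else 0) x + c n * g n x);
        [apply C0_lincomb; auto|].
      apply functional_extensionality; intros x. rewrite <- (disjoint_sum_unit n).
      unfold disjoint_sum. set (k := epsilon _ _).
      destruct (lt_dec k n), (lt_dec k (S n)), (Nat.eq_dec k n); try lia; try ring.
      subst k. rewrite e. ring. }
  exists (disjoint_sum (fun k => if lt_dec k N then c k else 0)). split; [apply Hfin|].
  intros x. unfold disjoint_sum. set (k := epsilon _ _).
  destruct (lt_dec k N).
  - rewrite Rminus_diag, Rabs_R0. lra.
  - replace (c k * g k x - 0 * g k x) with (c k * g k x) by ring.
    rewrite Rabs_mult. pose proof (HN k ltac:(lia)). pose proof (g_le1 k x).
    pose proof (Rabs_pos (c k)). pose proof (Rabs_pos (g k x)). nra.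
Qed.

End Disjoint.

(** Any pointwise bound [M] stands in for the supremum norm, so evaluations [fun u => T u y] and the
    operators on [c_0] derived from them are handled without computing suprema. *)
Definition bounded_linear_on_C0 {K} (tK : Topology K) {X : NormedSpace}
  (S : (K -> R) -> X) (B : R) : Prop :=
  (forall a b u v, C0 tK R_NS u -> C0 tK R_NS v ->
     S (fun x => a * u x + b * v x) = vadd (vscal a (S u)) (vscal b (S v))) /\
  (forall u M, C0 tK R_NS u -> 0 <= M -> (forall x, Rabs (u x) <= M) ->
     vnorm (S u) <= B * M).

(** * James' distortion argument for operators on [c_0] *)

Section James.
Context {X : NormedSpace} (S : (nat -> R) -> X) (B : R).
Context (S_bl : bounded_linear_on_C0 (discrete_topology nat) S B).

Definition unit_tail (N : nat) (u : nat -> R) : Prop :=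
  c0 u /\ (forall i, Rabs (u i) <= 1) /\ (forall i, (i < N)%nat -> u i = 0).

Definition unit_c0 (m k : nat) : R := if Nat.eq_dec k m then 1 else 0.

Lemma unit_c0_tail m : unit_tail m (unit_c0 m).
Proof.
  split; [|split].
  - apply c0_iff. intros eps He. exists (1 + m)%nat. intros n Hn. unfold unit_c0.
    destruct Nat.eq_dec; [lia|]. rewrite Rabs_R0. lra.
  - intros i. unfold unit_c0. destruct Nat.eq_dec; rewrite ?Rabs_R0, ?Rabs_R1; lra.
  - intros i Hi. unfold unit_c0. destruct Nat.eq_dec; [lia|auto].
Qed.

Lemma tail_constant eps :
  eps > 0 -> (forall m, vnorm (S (unit_c0 m)) >= eps) ->
  exists b N0, b > 0 /\
    (forall u, unit_tail N0 u -> vnorm (S u) <= b) /\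
    (forall N, exists u, unit_tail N u /\ vnorm (S u) > 2/3 * b).
Proof.
  intros He Hm.
  set (E := fun b => exists N, forall u, unit_tail N u -> vnorm (S u) <= b).
  assert (EB : E (B * 1)).
  { exists 0%nat. intros u [H1 [H2 _]]. apply (proj2 S_bl); auto; lra. }
  assert (Ege : forall b, E b -> b >= eps).
  { intros b [N HN]. pose proof (HN _ (unit_c0_tail N)). specialize (Hm N). lra. }
  assert (H : exists b, E b /\ ~ E (2/3 * b)).
  { apply NNPP. intros Hno.
    assert (Hall : forall n, E ((2/3) ^ n * (B * 1))).
    { induction n as [|n IH]; [rewrite Rmult_1_l; exact EB|].
      apply NNPP. intros nE. apply Hno. eexists. split; [exact IH|].
      intros E'. apply nE. simpl. rewrite Rmult_assoc. exact E'. }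
    pose proof (Ege _ EB).
    destruct (pow_lt_1_zero (2/3)) with (y := eps / B) as [n Hn];
      [rewrite Rabs_right; lra|apply Rdiv_lt_0_compat; lra|].
    specialize (Hn n (le_n n)). rewrite Rabs_right in Hn; [|apply Rle_ge, pow_le; lra].
    pose proof (Ege _ (Hall n)).
    apply Rmult_lt_compat_r with (r := B) in Hn; [|lra].
    replace (eps / B * B) with eps in Hn by (field; lra). lra. }
  destruct H as [b [Eb nE]]. pose proof (Ege b Eb). destruct Eb as [N0 HN0].
  exists b, N0. split; [lra|]. split; [auto|]. intros N.
  apply NNPP. intros Hno. apply nE. exists N. intros u Hu.
  apply Rnot_gt_le. intros Hgt. apply Hno. eauto.
Qed.

Lemma tail_block b N :
  (forall N, exists u, unit_tail N u /\ vnorm (S u) > 2/3 * b) ->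
  exists p : nat * (nat -> R), (N <= fst p)%nat /\ unit_tail N (snd p) /\
    (forall i, (fst p <= i)%nat -> snd p i = 0) /\ vnorm (S (snd p)) > 2/3 * b.
Proof.
  intros H. destruct (H N) as [u [[Hc [H1 H0]] Hu]].
  pose proof (Rabs_pos B) as HB. pose proof (Rle_abs B).
  (* Truncating [u] where it falls below [eta] costs at most [B * eta] in the image, strictly less
     than the slack [(Rabs B + 1) * eta]. *)
  set (eta := (vnorm (S u) - 2/3 * b) / (Rabs B + 1)).
  assert (Heta : eta > 0) by (apply Rdiv_lt_0_compat; lra).
  destruct (proj1 (c0_iff u) Hc eta Heta) as [M0 HM0].
  set (M := (M0 + N)%nat).
  set (v := fun i => if lt_dec i M then u i else 0).
  assert (Hv : c0 v).
  { apply c0_iff. intros eps He. exists M. intros n Hn. unfold v.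
    destruct lt_dec; [lia|]. rewrite Rabs_R0; lra. }
  exists (M, v). simpl. split; [unfold M; lia|]. split; [split; [auto|split]|split].
  - intros i. unfold v. destruct lt_dec; [auto|rewrite Rabs_R0; lra].
  - intros i Hi. unfold v. destruct lt_dec; auto.
  - intros i Hi. unfold v. destruct lt_dec; [lia|auto].
  - set (w := fun i => 1 * u i + (-1) * v i).
    assert (Hw : c0 w) by (apply C0_lincomb; auto).
    assert (Hwn : vnorm (S w) <= B * eta).
    { apply (proj2 S_bl); [auto|lra|]. intros i. unfold w, v. destruct lt_dec.
      - replace (1 * u i + -1 * u i) with 0 by ring. rewrite Rabs_R0; lra.
      - replace (1 * u i + -1 * 0) with (u i) by ring.
        left. apply HM0. unfold M in *; lia. }
    assert (Eu : S u = vadd (vscal 1 (S v)) (vscal 1 (S w))).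
    { rewrite <- (proj1 S_bl); auto. f_equal.
      apply functional_extensionality. intros i. unfold w. ring. }
    pose proof (vnorm_lin 1 1 (S v) (S w)) as Hn. rewrite <- Eu, Rabs_R1 in Hn.
    assert (E : vnorm (S u) - 2/3 * b = (Rabs B + 1) * eta) by (unfold eta; field; lra).
    nra.
Qed.

(* James' distortion argument: on normalised blocks [g k] that almost realise the
   tail norm [b], a vector [h] and its reflection [h - 2 c_m g_m] both have image
   of norm at most [b], which forces both images to be large. *)
Lemma james eps :
  eps > 0 -> (forall m, vnorm (S (unit_c0 m)) >= eps) -> contains_c0 X.
Proof.
  intros He Hm. destruct (tail_constant eps He Hm) as [b [N0 [Hb [Hup Hlow]]]].
  set (next := fun N => proj1_sig (constructive_indefinite_description _ (tail_block b N Hlow))).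
  assert (Hnext : forall N, (N <= fst (next N))%nat /\ unit_tail N (snd (next N)) /\
    (forall i, (fst (next N) <= i)%nat -> snd (next N) i = 0) /\
    vnorm (S (snd (next N))) > 2/3 * b).
  { intros N. unfold next. apply proj2_sig. }
  clearbody next.
  set (p := fix p k := match k with O => N0 | Datatypes.S k => fst (next (p k)) end).
  set (g := fun k => snd (next (p k))).
  assert (pS : forall k, p (Datatypes.S k) = fst (next (p k))) by reflexivity.
  assert (pmono : forall j k, (j <= k)%nat -> (p j <= p k)%nat).
  { intros j k Hjk. induction Hjk; [lia|]. rewrite pS. destruct (Hnext (p m)). lia. }
  assert (gC : forall k, c0 (g k)) by (intros k; apply (Hnext (p k))).
  assert (g1 : forall k i, Rabs (g k i) <= 1) by (intros k; apply (Hnext (p k))).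
  assert (gsupp : forall k i, g k i <> 0 -> (p k <= i < p (Datatypes.S k))%nat).
  { intros k i Hi. destruct (Hnext (p k)) as [_ [[_ [_ H0]] [H1 _]]]. split.
    - apply Nat.nlt_ge. intros Hlt. apply Hi, H0, Hlt.
    - apply Nat.nle_gt. intros Hle. apply Hi, H1. rewrite <- pS. exact Hle. }
  assert (gdisj : forall j k i, g j i <> 0 -> g k i <> 0 -> j = k).
  { intros j k i Hj Hk. apply gsupp in Hj, Hk.
    destruct (Nat.lt_trichotomy j k) as [Hlt|[Heq|Hlt]]; [|auto|];
      apply pmono in Hlt; lia. }
  assert (JC : forall c, c0 c -> c0 (disjoint_sum g c)).
  { intros c Hc. apply disjoint_sum_C0; auto. }
  assert (Jup : forall c M, c0 c -> 0 <= M -> (forall k, Rabs (c k) <= M) ->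
                vnorm (S (disjoint_sum g c)) <= b * M).
  { intros c M Hc HM HcM. destruct HM as [HM|<-].
    (* All blocks start at or after [N0], so the normalised sum is in the tail where [b] is a bound.
       The zero term turns scaling into the two-term form in which linearity of [S] is stated. *)
    - set (v := fun i => / M * disjoint_sum g c i + 0 * disjoint_sum g c i).
      assert (Hv : unit_tail N0 v).
      { split; [apply C0_lincomb; apply JC; auto|]. split; intros i; unfold v.
        - pose proof (disjoint_sum_bound g g1 c M i HcM).
          replace (/ M * disjoint_sum g c i + 0 * disjoint_sum g c i)
            with (disjoint_sum g c i * / M) by ring.
          rewrite Rabs_mult, (Rabs_right (/ M));
            [|apply Rle_ge, Rlt_le, Rinv_0_lt_compat; auto].
          apply Rmult_le_reg_r with M; [auto|].
          rewrite Rmult_assoc, Rinv_l by lra. lra.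
        - intros Hi. rewrite disjoint_sum_off; [ring|]. intros k. apply NNPP. intros Hk.
          apply gsupp in Hk. assert (p 0%nat <= p k)%nat by (apply pmono; lia).
          change (p 0%nat) with N0 in *. lia. }
      specialize (Hup v Hv). unfold v in Hup.
      rewrite (proj1 S_bl), vnorm_lin_same in Hup by (apply JC; auto).
      rewrite Rabs_right in Hup; [|apply Rle_ge, Rlt_le, Rinv_0_lt_compat; auto].
      apply Rmult_le_compat_l with (r := M) in Hup; [|lra].
      rewrite <- Rmult_assoc, Rinv_r in Hup by lra. lra.
    - rewrite Rmult_0_r, <- (Rmult_0_r B). apply (proj2 S_bl); [apply JC; auto|lra|].
      intros i. apply disjoint_sum_bound; auto. }
  exists (fun c => S (disjoint_sum g c)). split.
  - intros a a' u v Hu Hv. rewrite <- (proj1 S_bl) by (apply JC; auto). f_equal.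
    apply functional_extensionality. intros i. apply disjoint_sum_lin.
  (* Reflecting coordinate [m] gives [2 * |u m| * (2/3 * b) <= n + b * s]; the supremum over [m]
     yields [b / 3 * s <= n]. A positive constant results because 2/3 exceeds 1/2. *)
  - exists (b / 3), b. split; [lra|]. split; [lra|]. intros u Hu.
    pose proof (supnorm_ge0 _ _ Hu) as Hs0.
    assert (Hs : forall i, Rabs (u i) <= supnorm (X := R_NS) u)
      by (intros i; apply (supnorm_ge _ _ i Hu)).
    split; [|apply Jup; auto].
    set (s := supnorm (X := R_NS) u) in *.
    set (n := vnorm (S (disjoint_sum g u))).
    assert (Hcoord : forall m, Rabs (u m) <= (n + b * s) / (4/3 * b)).
    { intros m.
      set (u' := fun k => if Nat.eq_dec k m then - u k else u k).
      assert (Habs : forall k, Rabs (u' k) = Rabs (u k)).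
      { intros k. unfold u'. destruct Nat.eq_dec; [apply Rabs_Ropp|auto]. }
      assert (Hu' : c0 u').
      { apply c0_iff. intros e Hpos. destruct (proj1 (c0_iff u) Hu e Hpos) as [N HN].
        exists N. intros k Hk. rewrite Habs. auto. }
      assert (Hn' : vnorm (S (disjoint_sum g u')) <= b * s).
      { apply Jup; auto. intros k. rewrite Habs. auto. }
      assert (E : (fun i => 1 * disjoint_sum g u i + (-1) * disjoint_sum g u' i)
                  = (fun i => 2 * u m * g m i + 0 * g m i)).
      { apply functional_extensionality. intros i.
        rewrite <- (disjoint_sum_unit g gdisj m). unfold disjoint_sum, u'.
        set (k := epsilon _ _). destruct (Nat.eq_dec k m) as [->|]; ring. }
      pose proof (vnorm_lin 1 (-1) (S (disjoint_sum g u)) (S (disjoint_sum g u'))) as Hl.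
      rewrite <- (proj1 S_bl), E, (proj1 S_bl), vnorm_lin_same in Hl
        by (apply JC || apply gC; auto).
      rewrite Rabs_R1, (Rabs_left (-1)), Rabs_mult, (Rabs_right 2) in Hl by lra.
      assert (Hg : vnorm (S (g m)) > 2/3 * b) by apply (Hnext (p m)).
      pose proof (Rabs_pos (u m)) as Hum.
      apply Rmult_le_reg_r with (4/3 * b); [lra|].
      replace ((n + b * s) / (4/3 * b) * (4/3 * b)) with (n + b * s) by (field; lra).
      fold n in Hl. nra. }
    assert (Hsup : s <= (n + b * s) / (4/3 * b)).
    { apply (supnorm_le (discrete_topology nat)); [exact Hu| |exact Hcoord].
      eapply Rle_trans; [apply Rabs_pos|apply (Hcoord 0%nat)]. }
    apply Rmult_le_compat_r with (r := 4/3 * b) in Hsup; [|lra].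
    replace ((n + b * s) / (4/3 * b) * (4/3 * b)) with (n + b * s) in Hsup by (field; lra).
    lra.
Qed.

End James.

(** Composing [S] with [disjoint_sum g] gives a bounded operator on [c_0] that sends the unit
    vectors to the [S (g k)]. *)
Lemma disjoint_large_contains_c0 {K} (tK : Topology K) {X : NormedSpace}
  (S : (K -> R) -> X) (B eps : R) (g : nat -> K -> R) :
  bounded_linear_on_C0 tK S B -> eps > 0 ->
  (forall k, C0 tK R_NS (g k)) -> (forall k x, Rabs (g k x) <= 1) ->
  (forall j k x, g j x <> 0 -> g k x <> 0 -> j = k) ->
  (forall k, vnorm (S (g k)) >= eps) ->
  contains_c0 X.
Proof.
  intros [Slin Sbd] He gC g1 gdisj gS.
  apply (james (fun c => S (disjoint_sum g c)) B) with eps; [split|auto|].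
  - intros a b u v Hu Hv. rewrite <- Slin by (apply disjoint_sum_C0; auto). f_equal.
    apply functional_extensionality. intros x. apply disjoint_sum_lin.
  - intros u M Hu HM Hb. apply Sbd; [apply disjoint_sum_C0; auto|auto|].
    intros x. apply disjoint_sum_bound; auto.
  - intros m. unfold unit_c0. rewrite disjoint_sum_unit; auto.
Qed.

(** * A dyadic tree of functions on a non-scattered space *)

Definition bump_on {K} (tK : Topology K) (O U : K -> Prop) (f : K -> R) : Prop :=
  C0 tK R_NS f /\ (forall x, 0 <= f x <= 1) /\
  (forall x, O x -> f x = 1) /\ (forall x, f x <> 0 -> U x).

(** Two shrinkings are made so that the function vanishes off [W], and the compact set between [W]
    and [U] secures vanishing at infinity. *)
Lemma bump_exists {K} (tK : Topology K) (U : K -> Prop) x :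
  lch tK -> is_open tK U -> U x ->
  exists O f, is_open tK O /\ O x /\ bump_on tK O U f.
Proof.
  intros LK HU Ux. destruct (lch_shrink tK U x LK HU Ux) as [W [HW [Wx WU]]].
  destruct WU as [C [HC [WC CU]]].
  destruct (lch_shrink tK W x LK HW Wx) as [O [HO [Ox OW]]].
  destruct (urysohn tK LK O W HO HW OW) as [f [Hc [Hr [H1 H0]]]].
  exists O, f. split; [auto|]. split; [auto|]. split; [|split; [auto|split; [auto|]]].
  - apply C0_R_NS. split; [auto|]. intros eps He. exists C. split; [auto|].
    intros y nCy. rewrite H0, Rabs_R0 by auto. lra.
  - intros y Hy. apply CU, WC. apply NNPP. auto.
Qed.

(** Lists grow at the head: ancestors of a node are its suffixes, and [u ++ s] ranges over [s] and
    its descendants. *)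
Definition dyadic_tree {K} (tK : Topology K) (f : list bool -> K -> R) : Prop :=
  (forall s, C0 tK R_NS (f s)) /\
  (forall s x, 0 <= f s x <= 1) /\
  (forall s, exists x, f s x = 1) /\
  (forall b s x, f (b :: s) x <> 0 -> f s x = 1) /\
  (forall s x, f (true :: s) x <> 0 -> f (false :: s) x = 0).

(** Each node carries an open set that meets [A] and on which its function is 1. As [A] has no
    isolated point, a second point of [A] lies there, and the children are bumps in disjoint
    neighbourhoods of the two points. *)
Lemma dyadic_tree_exists {K} (tK : Topology K) :
  lch tK -> ~ scattered tK -> exists f, dyadic_tree tK f.
Proof.
  intros LK HnS. apply not_all_ex_not in HnS. destruct HnS as [A HA].
  apply imply_to_and in HA. destruct HA as [[a Aa] HA].
  assert (Hperf : forall x U, A x -> is_open tK U -> U x -> exists y, A y /\ U y /\ y <> x).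
  { intros x U Ax HU Ux. apply NNPP. intros Hno. apply HA. exists x. split; [auto|].
    exists U. split; [auto|]. split; [auto|]. intros y Ay Uy.
    apply NNPP. intros n. apply Hno. exists y. auto. }
  set (node := fun p : (K -> Prop) * (K -> R) =>
         is_open tK (fst p) /\ (exists x, A x /\ fst p x) /\
         bump_on tK (fst p) (fun _ => True) (snd p)).
  assert (Hsplit : forall p : {p | node p}, exists q : bool -> {q | node q},
     (forall b x, snd (proj1_sig (q b)) x <> 0 -> snd (proj1_sig p) x = 1) /\
     (forall x, snd (proj1_sig (q true)) x <> 0 -> snd (proj1_sig (q false)) x = 0)).
  { intros [[O f] Hn]. pose proof Hn as [HO [[x [Ax Ox]] [Hf [Hf01 [Hf1 _]]]]]. simpl in *.
    destruct (Hperf x O Ax HO Ox) as [y [Ay [Oy nxy]]].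
    destruct (proj2 LK x y) as [U [V [HU [HV [Ux [Vy UV]]]]]]; [auto|].
    destruct (bump_exists tK (fun z => O z /\ U z) x LK) as [O1 [f1 [HO1 [Ox1 B1]]]];
      [apply open_inter; auto|auto|].
    destruct (bump_exists tK (fun z => O z /\ V z) y LK) as [O2 [f2 [HO2 [Oy2 B2]]]];
      [apply open_inter; auto|auto|].
    assert (N1 : node (O1, f1)).
    { split; [auto|]. split; [exists x; auto|]. destruct B1 as [? [? [? ?]]].
      split; auto. }
    assert (N2 : node (O2, f2)).
    { split; [auto|]. split; [exists y; auto|]. destruct B2 as [? [? [? ?]]].
      split; auto. }
    destruct B1 as [_ [_ [_ S1]]], B2 as [_ [_ [_ S2]]].
    exists (fun b => if b : bool then exist _ _ N1 else exist _ _ N2). simpl. split.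
    - intros [|] z Hz; simpl in Hz; apply Hf1; [apply (S1 z Hz)|apply (S2 z Hz)].
    - intros z Hz. apply NNPP. intros Hz'. apply (UV z); [apply (S1 z Hz)|apply (S2 z Hz')]. }
  set (child := fun p => proj1_sig (constructive_indefinite_description _ (Hsplit p))).
  assert (Hchild : forall p,
     (forall b x, snd (proj1_sig (child p b)) x <> 0 -> snd (proj1_sig p) x = 1) /\
     (forall x, snd (proj1_sig (child p true)) x <> 0 ->
                snd (proj1_sig (child p false)) x = 0)).
  { intros p. unfold child. apply proj2_sig. }
  clearbody child.
  destruct (bump_exists tK (fun _ => True) a LK (open_full _ tK) I) as [O [f0 [HO [Oa B]]]].
  assert (N : node (O, f0)) by (split; [auto|]; split; [exists a; auto|exact B]).
  set (tree := fix tree s := match s with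
                             | [] => exist _ _ N
                             | b :: s => child (tree s) b
                             end).
  assert (Hnode : forall s, node (proj1_sig (tree s))) by (intros s; apply proj2_sig).
  exists (fun s => snd (proj1_sig (tree s))). repeat split.
  - apply (Hnode s).
  - apply (Hnode s).
  - apply (Hnode s).
  - apply (Hnode s).
  - intros s. destruct (Hnode s) as [_ [[x [_ Ox]] [_ [_ [H1 _]]]]]. eauto.
  - intros b s x. apply (Hchild (tree s)).
  - intros s x. apply (Hchild (tree s)).
Qed.

Section Tree.
Context {K : Type} (tK : Topology K) (f : list bool -> K -> R).
Context (tree : dyadic_tree tK f).

Lemma tree_supp u s x : f (u ++ s) x <> 0 -> f s x <> 0.
Proof.
  induction u as [|b u IH]; simpl; [auto|].
  intros H. apply IH. rewrite (proj1 (proj2 (proj2 (proj2 tree))) b (u ++ s) x H). lra.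
Qed.

Lemma tree_one u s x : f (u ++ s) x = 1 -> f s x = 1.
Proof.
  induction u as [|b u IH]; simpl; [auto|].
  intros H. apply IH. apply (proj1 (proj2 (proj2 (proj2 tree))) b). lra.
Qed.

Definition comb (k : nat) (s : list bool) : list bool := repeat true k ++ s.

(* The nodes [false :: comb k s] branch off the path [comb k s] at distinct
   levels, so functions sitting above them are disjoint. *)
Lemma comb_disjoint (u : nat -> list bool) s j k x :
  f (u j ++ false :: comb j s) x <> 0 -> f (u k ++ false :: comb k s) x <> 0 -> j = k.
Proof.
  assert (H : forall j k, (j < k)%nat ->
    f (u j ++ false :: comb j s) x <> 0 -> f (u k ++ false :: comb k s) x <> 0 -> False).
  { clear j k. intros j k Hjk Hj Hk. apply tree_supp in Hj, Hk.
    apply Hj. apply (proj2 (proj2 (proj2 (proj2 tree)))).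
    (* For [j < k] the side node at level [k] descends from [true :: comb j s], the sibling of
       [false :: comb j s]. *)
    apply (tree_supp (false :: repeat true (k - j - 1))).
    replace ((false :: repeat true (k - j - 1)) ++ true :: comb j s)
      with (false :: comb k s); [exact Hk|].
    simpl. f_equal. change (true :: comb j s) with (repeat true (1 + j) ++ s).
    rewrite app_assoc, <- repeat_app. unfold comb. do 2 f_equal. lia. }
  intros Hj Hk. destruct (Nat.lt_trichotomy j k) as [Hlt|[Heq|Hlt]];
    [exfalso; eauto|auto|exfalso; eauto].
Qed.

(** Otherwise every side node [false :: comb k s] has a descendant with large image; these functions
    are disjoint and would force a copy of [c_0] in [X]. *)
Lemma node_small {X : NormedSpace} (S : (K -> R) -> X) B eps s :
  ~ contains_c0 X -> bounded_linear_on_C0 tK S B -> eps > 0 ->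
  exists u, forall v, vnorm (S (f (v ++ u ++ s))) < eps.
Proof.
  intros HX HS He. apply NNPP. intros Hno.
  assert (H : forall u, exists v, vnorm (S (f (v ++ u ++ s))) >= eps).
  { intros u. apply NNPP. intros Hv. apply Hno. exists u. intros v.
    apply Rnot_ge_lt. intros Hge. apply Hv. eauto. }
  set (v := fun k => proj1_sig (constructive_indefinite_description _
                       (H (false :: repeat true k)))).
  assert (Hv : forall k, vnorm (S (f (v k ++ false :: comb k s))) >= eps).
  { intros k. unfold v. apply (proj2_sig (constructive_indefinite_description _
                       (H (false :: repeat true k)))). }
  apply HX.
  apply (disjoint_large_contains_c0 tK S B eps (fun k => f (v k ++ false :: comb k s)));
    [auto|auto| | | |auto].
  - intros k. apply tree.
  - intros k x. destruct tree as [_ [H01 _]]. apply Rabs_le.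
    specialize (H01 (v k ++ false :: comb k s) x). lra.
  - intros j k x. apply comb_disjoint.
Qed.

End Tree.

(** * Countable families of functions on a scattered space *)

Lemma list_bool_enumerable : exists e : nat -> list bool, forall s, exists n, e n = s.
Proof.
  set (dec := fix dec p := match p with
                | xH => []
                | xO p => false :: dec p
                | xI p => true :: dec p
                end).
  exists (fun n => dec (Pos.of_nat n)). intros s.
  assert (H : exists p, dec p = s).
  { induction s as [|[|] s [p Hp]]; [exists xH|exists (xI p)|exists (xO p)];
      simpl; congruence. }
  destruct H as [p Hp]. exists (Pos.to_nat p). rewrite Pos2Nat.id. exact Hp.
Qed.

Section CountableImage.
Context {L I : Type} (tL : Topology L) {X : NormedSpace} (F : I -> L -> X).
Context (enum : nat -> I).
Context (enum_surj : forall i, exists n, enum n = i).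

(** Countability of the set of families [(F i y)_i] for [y] in [D]. The list [e] may contain
    families that no point attains, which spares separate finite and empty cases. *)
Definition countable_image (D : L -> Prop) : Prop :=
  exists e : nat -> I -> X, forall y, D y -> exists k, forall i, F i y = e k i.

Lemma countable_image_sub (D E : L -> Prop) :
  (forall y, D y -> E y) -> countable_image E -> countable_image D.
Proof. intros DE [e He]. exists e. auto. Qed.

Lemma countable_image_Union (D : nat -> L -> Prop) :
  (forall n, countable_image (D n)) -> countable_image (fun y => exists n, D n y).
Proof.
  intros H.
  set (e := fun n => proj1_sig (constructive_indefinite_description _ (H n))).
  assert (He : forall n y, D n y -> exists k, forall i, F i y = e n k i).
  { intros n. unfold e. apply (proj2_sig (constructive_indefinite_description _ (H n))). }
  exists (fun m => e (fst (Cantor.of_nat m)) (snd (Cantor.of_nat m))).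
  intros y [n Dy]. destruct (He n y Dy) as [k Hk].
  exists (Cantor.to_nat (n, k)). rewrite Cantor.cancel_of_to. exact Hk.
Qed.

Lemma countable_image_or (D E : L -> Prop) :
  countable_image D -> countable_image E -> countable_image (fun y => D y \/ E y).
Proof.
  intros HD HE.
  apply countable_image_sub with (fun y => exists n, (match n with O => D | _ => E end) y).
  - intros y [Dy|Ey]; [exists 0%nat|exists 1%nat]; auto.
  - apply countable_image_Union. intros [|n]; auto.
Qed.

Lemma countable_image_point (D : L -> Prop) (c : I -> X) :
  (forall y, D y -> forall i, F i y = c i) -> countable_image D.
Proof. intros H. exists (fun _ => c). intros y Dy. exists 0%nat. auto. Qed.

(* Points at which some [F i] differs from [c i] are exhausted by countably many
   sets [|F i - c i| >= 1/(n+1)]. *)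
Lemma countable_image_near (D : L -> Prop) (c : I -> X) :
  (forall i eps, eps > 0 ->
     countable_image (fun y => D y /\ vnorm (vsub (F i y) (c i)) >= eps)) ->
  countable_image D.
Proof.
  intros H.
  set (pt := fun m => enum (fst (Cantor.of_nat m))).
  set (ep := fun m => / (INR (snd (Cantor.of_nat m)) + 1)).
  apply countable_image_sub with (fun y =>
    (exists m, D y /\ vnorm (vsub (F (pt m) y) (c (pt m))) >= ep m) \/
    (D y /\ forall i, F i y = c i)).
  - intros y Dy. destruct (classic (forall i, F i y = c i)) as [Hc|Hc]; [auto|left].
    apply not_all_ex_not in Hc. destruct Hc as [i Hi].
    destruct (enum_surj i) as [a Ha].
    assert (Hpos : 0 < vnorm (vsub (F i y) (c i))).
    { destruct (vnorm_pos (vsub (F i y) (c i))) as [|Heq]; [auto|].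
      elim Hi. apply vsub_eq0. auto. }
    destruct (archimed_cor1 _ Hpos) as [n [Hn Hn0]].
    exists (Cantor.to_nat (a, n)). unfold pt, ep. rewrite Cantor.cancel_of_to. simpl.
    rewrite Ha. split; [auto|]. apply Rle_ge. left. eapply Rle_lt_trans; [|exact Hn].
    apply Rinv_le_contravar; [apply lt_0_INR; auto|lra].
  - apply countable_image_or.
    + apply countable_image_Union. intros m. apply H. unfold ep.
      apply Rinv_0_lt_compat. pose proof (pos_INR (snd (Cantor.of_nat m))). lra.
    + apply countable_image_point with c. tauto.
Qed.

(** Near [y], compare with the family of [y] itself: for each [i] and [eps], the points of [Q] where
    [F i] is [eps]-far from [F i y] form a compact set missing [y]. Globally, compare with 0 and use
    vanishing at infinity. *)
Lemma scattered_countable_image :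
  lch tL -> scattered tL -> (forall i, C0 tL X (F i)) -> countable_image (fun _ => True).
Proof.
  intros LL SL HF.
  assert (Hcomp : forall C, compact tL C -> countable_image C).
  { apply (scattered_ind tL countable_image SL).
    - apply countable_image_point with (fun _ => vzero). tauto.
    - apply countable_image_sub.
    - apply countable_image_or.
    - intros y U HU Uy HC.
      destruct (lch_shrink tL U y LL HU Uy) as [V [HV [Vy [Q [HQ [VQ QU]]]]]].
      exists V. split; [auto|]. split; [auto|].
      apply countable_image_sub with Q; [auto|].
      apply countable_image_near with (fun i => F i y). intros i eps He. apply HC.
      (* Subtracting the constant [F i y] may destroy vanishing at infinity, so
         [C0_superlevel_compact] is not applied and openness of the complement is checked by
         hand. *)
      + replace (fun z => Q z /\ vnorm (vsub (F i z) (F i y)) >= eps)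
          with (fun z => Q z /\ ~ vnorm (vsub (F i z) (F i y)) < eps).
        * apply compact_minus_open; [auto|]. apply open_local. intros z Hz.
          destruct (proj1 (HF i) z (eps - vnorm (vsub (F i z) (F i y)))) as [O [HO [Oz HOw]]];
            [lra|].
          exists O. split; [auto|]. split; [auto|]. intros w Ow. specialize (HOw w Ow).
          assert (E : vsub (F i w) (F i y) = vadd (vsub (F i w) (F i z)) (vsub (F i z) (F i y))).
          { unfold vsub at 1 3. rewrite vadd_assoc, vsub_add. reflexivity. }
          rewrite E. eapply Rle_lt_trans; [apply vnorm_triang|]. lra.
        * apply functional_extensionality; intros z. apply propositional_extensionality.
          split; intros [H1 H2]; split; auto; lra.
      + intros z [Qz _]. auto.
      + intros [_ Hy]. unfold vsub in Hy. rewrite vadd_opp, vnorm_zero in Hy. lra. }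
  apply countable_image_near with (fun _ => vzero). intros i eps He.
  destruct (proj2 (HF i) eps He) as [C [HC HCx]].
  apply countable_image_sub with C; [|auto].
  intros y [_ Hy]. apply NNPP. intros nCy. specialize (HCx y nCy).
  pose proof (vnorm_lin 1 (-1) (F i y) (vzero : X)) as H.
  rewrite vscal_one, Rabs_R1, vnorm_zero in H. unfold vsub in Hy. lra.
Qed.

End CountableImage.

(** * Convex combinations of pointwise null sequences *)

Inductive hull {D : Type} (E : (D -> R) -> Prop) : (D -> R) -> Prop :=
| hull_in u : E u -> hull E u
| hull_mix a u v : 0 <= a <= 1 -> hull E u -> hull E v ->
    hull E (fun x => a * u x + (1 - a) * v x).

Definition tail {D : Type} (h : nat -> D -> R) (N : nat) (v : D -> R) : Prop :=
  exists n, (N <= n)%nat /\ v = h n.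

Lemma hull_trans {D} (E E' : (D -> R) -> Prop) v :
  (forall u, E u -> hull E' u) -> hull E v -> hull E' v.
Proof. intros H. induction 1; [auto|apply hull_mix; auto]. Qed.

Lemma hull_tail_mono {D} (h : nat -> D -> R) M N v :
  (M <= N)%nat -> hull (tail h N) v -> hull (tail h M) v.
Proof.
  intros HMN. apply hull_trans. intros u [n [Hn ->]]. apply hull_in.
  exists n. split; [lia|auto].
Qed.

Lemma hull_le {D} (E : (D -> R) -> Prop) M x v :
  (forall u, E u -> u x <= M) -> hull E v -> v x <= M.
Proof. intros H. induction 1; [auto|nra]. Qed.

Lemma hull_lt {D} (E : (D -> R) -> Prop) M x v :
  (forall u, E u -> u x < M) -> hull E v -> v x < M.
Proof.
  intros H. induction 1 as [u Hu|a u v Ha _ IHu _ IHv]; [auto|].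
  (* One of the two weights is at least 1/2, so strictness survives. *)
  destruct (Rle_lt_dec a (1/2)); nra.
Qed.

Lemma hull_ge {D} (E : (D -> R) -> Prop) M x v :
  (forall u, E u -> M <= u x) -> hull E v -> M <= v x.
Proof. intros H. induction 1; [auto|nra]. Qed.

Lemma hull_C0 {D} (tD : Topology D) (E : (D -> R) -> Prop) v :
  (forall u, E u -> C0 tD R_NS u) -> hull E v -> C0 tD R_NS v.
Proof. intros H. induction 1; [auto|apply C0_lincomb; auto]. Qed.

Section ScatteredMazur.
Context {L : Type} (tL : Topology L) (B : R).

Definition null_seq (h : nat -> L -> R) : Prop :=
  (forall n, C0 tL R_NS (h n)) /\ (forall n y, 0 <= h n y <= B) /\
  (forall y eps, eps > 0 -> exists N, forall n, (N <= n)%nat -> h n y < eps).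

(** Quantifying over every null sequence inside the property lets it be reapplied to sequences of
    convex blocks. *)
Definition mazur_on (D : L -> Prop) : Prop :=
  forall h eps, null_seq h -> eps > 0 ->
    exists v, hull (tail h 0) v /\ forall y, D y -> v y < eps.

Lemma null_seq_blocks h v :
  null_seq h -> (forall n, hull (tail h n) (v n)) -> null_seq v.
Proof.
  intros [HC [HB H0]] Hv. split; [|split].
  - intros n. apply hull_C0 with (tail h n); [|auto]. intros u [m [_ ->]]. auto.
  - intros n y. split; [apply hull_ge with (tail h n)|apply hull_le with (tail h n)]; auto;
      intros u [m [_ ->]]; apply HB.
  - intros y eps He. destruct (H0 y eps He) as [N HN]. exists N. intros n Hn.
    apply hull_lt with (tail h n); [|auto]. intros u [m [Hm ->]]. apply HN. lia.
Qed.

Lemma mazur_on_tail D h N eps :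
  mazur_on D -> null_seq h -> eps > 0 ->
  exists v, hull (tail h N) v /\ forall y, D y -> v y < eps.
Proof.
  intros HD Hh He.
  destruct (HD (fun n => h (n + N)%nat) eps) as [v [Hv Hy]]; [|auto|].
  - apply null_seq_blocks with h; [auto|]. intros n. apply hull_in.
    exists (n + N)%nat. split; [lia|auto].
  - exists v. split; [|auto]. revert Hv. apply hull_trans. intros u [n [_ ->]].
    apply hull_in. exists (n + N)%nat. split; [lia|auto].
Qed.

Lemma mazur_on_sub (D E : L -> Prop) :
  (forall y, D y -> E y) -> mazur_on E -> mazur_on D.
Proof.
  intros DE HE h eps Hh He. destruct (HE h eps Hh He) as [v [Hv Hy]]. eauto.
Qed.

(** From each tail take a convex combination small on [D]. These form a null sequence again, and a
    combination of them that is small on [E] remains small on [D]. *)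
Lemma mazur_on_or (D E : L -> Prop) :
  mazur_on D -> mazur_on E -> mazur_on (fun y => D y \/ E y).
Proof.
  intros HD HE h eps Hh He.
  set (H := fun n => mazur_on_tail D h n eps HD Hh He).
  set (v := fun n => proj1_sig (constructive_indefinite_description _ (H n))).
  assert (Hv : forall n, hull (tail h n) (v n) /\ forall y, D y -> v n y < eps).
  { intros n. unfold v. apply (proj2_sig (constructive_indefinite_description _ (H n))). }
  destruct (HE v eps) as [w [Hw Hy]]; [|auto|].
  - apply null_seq_blocks with h; [auto|]. apply Hv.
  - exists w. split.
    + revert Hw. apply hull_trans. intros u [n [_ ->]].
      apply hull_tail_mono with n; [lia|apply Hv].
    + intros y [Dy|Ey]; [|auto]. apply hull_lt with (tail v 0); [|auto].
      intros u [n [_ ->]]. apply Hv; auto.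
Qed.

(* Average [k] hull elements, each chosen small on the union of the bad sets of
   its predecessors: every point is bad for at most one of them. *)
Lemma mazur_on_average (D : L -> Prop) :
  (forall h eps, null_seq h -> eps > 0 -> exists N, forall v, hull (tail h N) v ->
     mazur_on (fun y => D y /\ v y >= eps)) ->
  mazur_on D.
Proof.
  intros H h eps Hh He.
  destruct (H h (eps / 2) Hh) as [N HN]; [lra|].
  assert (HB : forall v y, hull (tail h N) v -> v y <= B).
  { intros v y Hv. apply hull_le with (tail h N); [|auto].
    intros u [n [_ ->]]. apply (proj1 (proj2 Hh)). }
  (* Here [v] is a mean of [k + 1] hull elements and [C] is the union of their bad sets. A point is
     bad for at most one of them, whose share is at most [B / (k + 1)]. *)
  assert (Hk : forall k, exists v C, hull (tail h N) v /\ mazur_on C /\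
     (forall y, D y -> ~ C y -> v y < eps / 2) /\
     (forall y, D y -> v y <= eps / 2 + B / (INR k + 1))).
  { induction k as [|k [v [C [Hv [HC [Hsmall Hlarge]]]]]].
    - assert (Hv : hull (tail h N) (h N)) by (apply hull_in; exists N; auto).
      exists (h N), (fun y => D y /\ h N y >= eps / 2).
      split; [auto|]. split; [auto|]. split.
      + intros y Dy nC. apply Rnot_ge_lt. intros Hge. auto.
      + intros y Dy. specialize (HB (h N) y Hv). simpl. lra.
    - destruct (mazur_on_tail C h N (eps / 2) HC Hh) as [w [Hw HwC]]; [lra|].
      (* This weight turns the mean of [k + 1] functions into the mean of [k + 2], giving the new
         [w] weight [1 / (k + 2)]. *)
      set (a := (INR k + 1) / (INR k + 2)). pose proof (pos_INR k) as Hpos.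
      assert (Ha : 0 <= a <= 1).
      { unfold a. split; [apply Rlt_le, Rdiv_lt_0_compat; lra|].
        apply Rmult_le_reg_r with (INR k + 2); [lra|]. field_simplify; lra. }
      exists (fun y => a * v y + (1 - a) * w y), (fun y => C y \/ (D y /\ w y >= eps / 2)).
      split; [apply hull_mix; auto|]. split; [apply mazur_on_or; auto|]. split.
      + intros y Dy nC. assert (v y < eps / 2) by auto.
        assert (w y < eps / 2) by (apply Rnot_ge_lt; intros Hge; auto).
        destruct (Rle_lt_dec a (1/2)); nra.
      + intros y Dy. rewrite S_INR.
        assert (E : B / (INR k + 1 + 1) = a * (B / (INR k + 1))) by (unfold a; field; lra).
        assert (E' : B / (INR k + 1 + 1) = (1 - a) * B) by (unfold a; field; lra).
        destruct (classic (C y)) as [Cy|nCy].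
        * specialize (HwC y Cy). specialize (Hlarge y Dy). rewrite E. nra.
        * specialize (Hsmall y Dy nCy). specialize (HB w y Hw). rewrite E'.
          nra. }
  destruct (archimed_cor1 (eps / (2 * (Rabs B + 1)))) as [n [Hn Hn0]].
  { apply Rdiv_lt_0_compat; [lra|]. pose proof (Rabs_pos B). lra. }
  destruct (Hk n) as [v [C [Hv [_ [_ Hlarge]]]]].
  exists v. split; [apply hull_tail_mono with N; [lia|auto]|].
  intros y Dy. specialize (Hlarge y Dy).
  assert (B / (INR n + 1) < eps / 2); [|lra].
  pose proof (Rabs_pos B). pose proof (Rle_abs B). apply lt_0_INR in Hn0.
  assert (Hinv : / (INR n + 1) <= / INR n) by (apply Rinv_le_contravar; lra).
  assert (0 < / (INR n + 1)) by (apply Rinv_0_lt_compat; lra).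
  assert (E : eps / 2 = (Rabs B + 1) * (eps / (2 * (Rabs B + 1)))) by (field; lra).
  unfold Rdiv at 1. nra.
Qed.

(** All convex combinations of a far enough tail are below [eps] at [y], so their superlevel sets in
    [Q] are compact and miss [y]: exactly what averaging asks for. On all of [L], superlevel sets
    lie in compact sets. *)
Lemma scattered_mazur : lch tL -> scattered tL -> mazur_on (fun _ => True).
Proof.
  intros LL SL.
  assert (HCv : forall h N v, null_seq h -> hull (tail h N) v -> C0 tL R_NS v).
  { intros h N v [HC _]. apply hull_C0. intros u [n [_ ->]]. auto. }
  assert (Hpos : forall h N v y, null_seq h -> hull (tail h N) v -> 0 <= v y).
  { intros h N v y [_ [HB _]]. apply hull_ge. intros u [n [_ ->]]. apply HB. }
  assert (Habs : forall h N v y, null_seq h -> hull (tail h N) v -> @vnorm R_NS (v y) = v y).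
  { intros h N v y Hh Hv. apply Rabs_right. apply Rle_ge. eauto. }
  assert (Hcomp : forall C, compact tL C -> mazur_on C).
  { apply (scattered_ind tL mazur_on SL).
    - intros h eps Hh He. exists (h 0%nat). split; [|tauto].
      apply hull_in. exists 0%nat. auto.
    - apply mazur_on_sub.
    - apply mazur_on_or.
    - intros y U HU Uy HC.
      destruct (lch_shrink tL U y LL HU Uy) as [V [HV [Vy [Q [HQ [VQ QU]]]]]].
      exists V. split; [auto|]. split; [auto|].
      apply mazur_on_average. intros h eps Hh He.
      destruct (proj2 (proj2 Hh) y eps He) as [N HN]. exists N. intros v Hv.
      apply mazur_on_sub with (fun z => Q z /\ @vnorm R_NS (v z) >= eps).
      { intros z [Vz Hz]. split; [auto|]. erewrite Habs; eauto. }
      apply HC.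
      + apply C0_superlevel_compact; eauto.
      + intros z [Qz _]. auto.
      + intros [_ Hy]. erewrite Habs in Hy by eauto.
        assert (v y < eps); [|lra]. apply hull_lt with (tail h N); [|auto].
        intros u [n [Hn ->]]. auto. }
  apply mazur_on_average. intros h eps Hh He. exists 0%nat. intros v Hv.
  destruct (proj2 (proj1 (C0_R_NS tL v) (HCv h 0%nat v Hh Hv)) eps He) as [C [HC Hx]].
  apply mazur_on_sub with C; [|auto].
  intros z [_ Hz]. apply NNPP. intros nCz. specialize (Hx z nCz).
  apply Rabs_def2 in Hx. lra.
Qed.

End ScatteredMazur.

(** * The pointwise null branch and the final contradiction *)

Lemma pointwise_null_branch {K L} (tK : Topology K) (tL : Topology L) {X : NormedSpace}
  (f : list bool -> K -> R) (T : (K -> R) -> L -> X) (B : R) :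
  dyadic_tree tK f -> lch tL -> scattered tL -> ~ contains_c0 X ->
  (forall s, C0 tL X (T (f s))) ->
  (forall y, bounded_linear_on_C0 tK (fun u => T u y) B) ->
  exists s : nat -> list bool,
    (forall m n, (m <= n)%nat -> exists u, s n = u ++ s m) /\
    forall y eps, eps > 0 -> exists N, forall n, (N <= n)%nat -> vnorm (T (f (s n)) y) < eps.
Proof.
  intros Htree LL SL HX HT HTbl.
  destruct list_bool_enumerable as [enum Henum].
  destruct (scattered_countable_image tL (fun s => T (f s)) enum Henum LL SL HT) as [e He].
  set (ep := fun m => / (INR (snd (Cantor.of_nat m)) + 1)).
  assert (Hep : forall m, ep m > 0).
  { intros m. apply Rinv_0_lt_compat. pose proof (pos_INR (snd (Cantor.of_nat m))). lra. }
  (* Stage [m] encodes a pair (value family, precision). Points sharing a family are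
     indistinguishable by the [T (f t)], so treating one of them treats all; an unattained family
     demands nothing. *)
  assert (Hstep : forall m s, exists u, forall v y,
    (forall t, T (f t) y = e (fst (Cantor.of_nat m)) t) ->
    vnorm (T (f (v ++ u ++ s)) y) < ep m).
  { intros m s.
    destruct (classic (exists y, forall t, T (f t) y = e (fst (Cantor.of_nat m)) t))
      as [[y Hy]|Hno].
    - destruct (node_small tK f Htree (fun u => T u y) B (ep m) s HX (HTbl y) (Hep m))
        as [u Hu].
      exists u. intros v z Hz. rewrite Hz, <- Hy. apply Hu.
    - exists []. intros v y Hy. exfalso. eauto. }
  set (next := fun m s => proj1_sig (constructive_indefinite_description _ (Hstep m s))).
  assert (Hnext : forall m s v y,
    (forall t, T (f t) y = e (fst (Cantor.of_nat m)) t) ->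
    vnorm (T (f (v ++ next m s ++ s)) y) < ep m).
  { intros m s. unfold next.
    apply (proj2_sig (constructive_indefinite_description _ (Hstep m s))). }
  set (s := fix s n := match n with O => [] | S n => next n (s n) ++ s n end).
  assert (Hext : forall m n, (m <= n)%nat -> exists u, s n = u ++ s m).
  { intros m n Hmn. induction Hmn as [|n _ [u Hu]]; [exists []; auto|].
    exists (next n (s n) ++ u). simpl. rewrite Hu at 2. apply app_assoc. }
  exists s. split; [exact Hext|]. intros y eps Heps.
  destruct (He y I) as [k Hk].
  destruct (archimed_cor1 eps Heps) as [n [Hn Hn0]].
  set (m := Cantor.to_nat (k, n)).
  (* The extension made at stage [m] is first present in [s (S m)], and its smallness is inherited
     by all descendants. *)
  exists (S m). intros n' Hn'. destruct (Hext _ _ Hn') as [u Hu]. rewrite Hu.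
  eapply Rlt_le_trans; [apply (Hnext m (s m) u y)|].
  - intros t. unfold m. rewrite Cantor.cancel_of_to. apply Hk.
  - unfold ep, m. rewrite Cantor.cancel_of_to. simpl.
    left. eapply Rle_lt_trans; [|exact Hn].
    apply Rinv_le_contravar; [apply lt_0_INR; auto|lra].
Qed.

Theorem theorem1p2 :
  forall (K L : Type) (tK : Topology K) (tL : Topology L) (X : NormedSpace),
    lch tK -> lch tL -> banach X -> ~ contains_c0 X ->
    (exists T : (K -> R_NS) -> (L -> X), iso_embedding_C0 tK R_NS tL X T) ->
    scattered tL ->
    scattered tK.
Proof.
  intros K L tK tL X LK LL _ HX [T [TC [Tlin [A [B [HA [HB HT]]]]]]] SL.
  apply NNPP. intros HnS.
  destruct (dyadic_tree_exists tK LK HnS) as [f Htree].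
  pose proof Htree as [fC [f01 [f1 [fsupp _]]]].
  assert (Tbd : forall u M y, C0 tK R_NS u -> 0 <= M -> (forall x, Rabs (u x) <= M) ->
                vnorm (T u y) <= B * M).
  { intros u M y Hu HM Hb.
    eapply Rle_trans; [apply (supnorm_ge tL); auto|].
    eapply Rle_trans; [apply HT; auto|].
    apply Rmult_le_compat_l; [lra|]. apply (supnorm_le tK); auto. }
  assert (Tlin' : forall a b u v, C0 tK R_NS u -> C0 tK R_NS v ->
    T (fun x => a * u x + b * v x) = lincomb a (T u) b (T v)).
  { intros a b u v. apply (Tlin a b u v). }
  destruct (pointwise_null_branch tK tL f T B Htree LL SL HX) as [s [Hs Hnull]].
  { intros t. apply TC, fC. }
  { intros y. split; [|intros; apply Tbd; auto].
    intros a b u v Hu Hv. rewrite Tlin' by auto. reflexivity. }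
  set (h := fun n y => vnorm (T (f (s n)) y)).
  (* Any level below [A] would do: the lifted function has norm at least 1, so its image has norm at
     least [A]. *)
  destruct (scattered_mazur tL B LL SL h (A / 2)) as [v [Hv Hsmall]]; [|lra|].
  { split; [|split].
    - intros n. apply (C0_norm tL), TC, fC.
    - intros n y. split; [apply vnorm_pos|]. rewrite <- (Rmult_1_r B).
      apply Tbd; [apply fC|lra|]. intros x. apply Rabs_le.
      specialize (f01 (s n) x). lra.
    - intros y eps He. apply Hnull, He. }
  (* The hull mixes the norms, not the functions. Mixing the functions with the same weights gives
     [u], and convexity of the norm gives [vnorm (T u y) <= w y]. The index [N] marks a node below
     all those used, where every one of them is 1. *)
  assert (Hlift : forall w, hull (tail h 0) w -> exists u N,
    C0 tK R_NS u /\ (forall x, f (s N) x = 1 -> u x = 1) /\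
    forall y, vnorm (T u y) <= w y).
  { intros w Hw. induction Hw as [w [n [_ ->]]|a w w' Ha _ [u [N [Hu [H1 Hy]]]]
                                  _ [u' [N' [Hu' [H1' Hy']]]]].
    - exists (f (s n)), n. split; [auto|]. split; [auto|]. intros y. apply Rle_refl.
    - exists (fun x => a * u x + (1 - a) * u' x), (N + N')%nat.
      split; [apply C0_lincomb; auto|]. split.
      + intros x Hx.
        destruct (Hs N (N + N')%nat) as [p Hp]; [lia|].
        destruct (Hs N' (N + N')%nat) as [p' Hp']; [lia|].
        rewrite H1, H1'; [change (a * 1 + (1 - a) * 1 = 1 :> R); ring| |].
        * rewrite Hp' in Hx. eapply tree_one; eauto.
        * rewrite Hp in Hx. eapply tree_one; eauto.
      + intros y. rewrite Tlin' by auto. eapply Rle_trans; [apply vnorm_lin|].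
        rewrite !Rabs_right by lra. specialize (Hy y). specialize (Hy' y). nra. }
  destruct (Hlift v Hv) as [u [N [Hu [H1 Hy]]]].
  destruct (f1 (s N)) as [x Hx].
  pose proof (supnorm_ge tK u x Hu) as Hge. rewrite (H1 x Hx) in Hge.
  simpl in Hge. rewrite Rabs_R1 in Hge.
  assert (Hle : supnorm (T u) <= A / 2).
  { apply (supnorm_le tL); [auto|lra|]. intros y. specialize (Hy y).
    specialize (Hsmall y I). lra. }
  destruct (HT u Hu) as [HTA _]. nra.
Qed.
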